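(* Let $n \geq 12$ and $2\leq s, t \leq n-2$ be integers such that either $s+t\leq n$, or $s+t>n$ and $s=t$. Then there exists a regular map $\mathcal{M}$ of order $2^n$ and type $\{2^s, 2^t\}$ with $\mathrm{Aut}(\mathcal{M})=G$, where $G$, with its distinguished generators $\rho_0,\rho_1,\rho_2$, is given by the following presentation. Put $$R_1=\{\rho_0^2,\ \rho_1^2,\ \rho_2^2,\ (\rho_0\rho_1)^{2^{s}},\ (\rho_1\rho_2)^{2^{t}},\ (\rho_0\rho_2)^2,\ [(\rho_0\rho_1)^4, \rho_2],\ [\rho_0,(\rho_1\rho_2)^4]\},$$ $$R_2=\{\rho_0^2,\ \rho_1^2,\ \rho_2^2,\ (\rho_0\rho_2)^2,\ (\rho_0\rho_1)^{2^{s}},\ (\rho_1\rho_2)^{2^{t}}\}.$$ (1) If $s+t\leq n-1$: when $n-s-t$ is odd, $$G=\langle \rho_0, \rho_1, \rho_2 \mid R_1,\ [(\rho_0\rho_1)^2, \rho_2]^{2^{\frac{n-s-t-1}{2}}}\rangle,$$ and when $n-s-t$ is even, $$G=\langle \rho_0, \rho_1, \rho_2 \mid R_1,\ [(\rho_0\rho_1)^2, (\rho_1\rho_2)^2]^{2^{\frac{n-s-t-2}{2}}}\rangle.$$ (2) If $s+t=n$: $$G=\langle \rho_0, \rho_1, \rho_2\mid R_2,\ [(\rho_0\rho_1)^2, \rho_2],\ (\rho_0\rho_1)^{2^{s-1}} (\rho_1\rho_2)^{2^{t-1}}\rangle.$$ (3) If $s+t>n$ and $s=t$: $$G=\langle \rho_0,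 \rho_1, \rho_2\mid R_2,\ (\rho_0\rho_1)^{2^{n-t-1}} (\rho_1\rho_2)^{2^{n-t-1}},\ [(\rho_0\rho_1)^2, \rho_2](\rho_2\rho_1)^{4}\rangle.$$
   Context: A (finite) regular map $\mathcal{M}$ is identified with a finite group $G=\mathrm{Aut}(\mathcal{M})$ together with an ordered triple of distinguished generators $(\rho_0,\rho_1,\rho_2)$ of $G$ such that $\rho_0,\rho_1,\rho_2$ and $\rho_0\rho_2$ all have order exactly $2$. The order of the regular map is $|G|$ (the number of flags of the map). The map has type $\{m,l\}$ if $\rho_0\rho_1$ has order exactly $m$ (the face length) and $\rho_1\rho_2$ has order exactly $l$ (the vertex valency). $[x,y]=x^{-1}y^{-1}xy$. In a presentation $\langle X\mid R\rangle$, the elements of $R$ are words set equal to $1$. *)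

(* Defs.v *)
From mathcomp Require Import all_boot all_fingroup.

Set Implicit Arguments.
Unset Strict Implicit.
Unset Printing Implicit Defensive.

Declare Scope word_scope.
Delimit Scope word_scope with W.

(* The library's [_ \isog Grp (_)] only determines the largest finite quotient
   of a presented group and does not record which elements the generators are
   sent to, so presentations are spelled out here. *)

(* The letter (x, false) stands for the generator x, (x, true) for x^-1. *)
Definition word (X : Type) : Type := seq (X * bool).
Bind Scope word_scope with word.

Section Words.
Variable X : Type.
Implicit Types (u v : word X) (x : X).

Definition wgen x : word X := [:: (x, false)].
Definition wmul u v : word X := u ++ v.
Definition winv u : word X := rev [seq (a.1, ~~ a.2) | a <- u].
Definition wexp u (k : nat) : word X := iter k (wmul u) [::].
Definition wcomm u v : word X := wmul (wmul (wmul (winv u) (winv v)) u) v.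

Definition letter_eval (gT : groupType) (f : X -> gT) (a : X * bool) : gT :=
  if a.2 then ((f a.1)^-1)%g else f a.1.

Definition word_eval (gT : groupType) (f : X -> gT) (u : word X) : gT :=
  foldr (fun a g => letter_eval f a * g)%g 1%g u.

End Words.

Notation "u * v" := (wmul u v) : word_scope.
Notation "u ^-1" := (winv u) : word_scope.
Notation "u ^+ k" := (wexp u k) : word_scope.
Notation "[~ u , v ]" := (wcomm u v) : word_scope.

(* u and v represent the same element of < X | R >, the quotient of the free
   monoid on the letters by the congruence generated by x x^-1 = x^-1 x = 1 and
   r = 1 for r in R. *)
Inductive pres_eq (X : eqType) (R : seq (word X)) : word X -> word X -> Prop :=
| pres_refl u : pres_eq R u u
| pres_sym u v : pres_eq R u v -> pres_eq R v u
| pres_trans u v w : pres_eq R u v -> pres_eq R v w -> pres_eq R u w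
| pres_mul u u' v v' :
    pres_eq R u u' -> pres_eq R v v' -> pres_eq R (u * v)%W (u' * v')%W
| pres_cancel x b : pres_eq R [:: (x, b); (x, ~~ b)] [::]
| pres_rel r : r \in R -> pres_eq R r [::].

(* x |-> f x induces an isomorphism from < X | R > onto gT. *)
Definition presents (X : eqType) (R : seq (word X)) (gT : groupType)
    (f : X -> gT) : Prop :=
  (forall g : gT, exists u : word X, word_eval f u = g) /\
  (forall u v : word X, word_eval f u = word_eval f v <-> pres_eq R u v).

Definition i0 : 'I_3 := @Ordinal 3 0 isT.
Definition i1 : 'I_3 := @Ordinal 3 1 isT.
Definition i2 : 'I_3 := @Ordinal 3 2 isT.

Record regular_map := RegularMap {
  Aut_map : finGroupType;
  rho : 'I_3 -> Aut_map;
  rho_generate : <<[set rho i | i in 'I_3]>>%g = [set: Aut_map];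
  rho_order2 : forall i, #[rho i]%g = 2;
  rho02_order2 : #[rho i0 * rho i2]%g = 2
}.

Definition map_order (M : regular_map) : nat := #|Aut_map M|.

Definition map_type (M : regular_map) (m l : nat) : Prop :=
  #[rho M i0 * rho M i1]%g = m /\ #[rho M i1 * rho M i2]%g = l.

Definition Aut_presented_by (M : regular_map) (R : seq (word 'I_3)) : Prop :=
  presents R (rho M).

Definition r0 : word 'I_3 := wgen i0.
Definition r1 : word 'I_3 := wgen i1.
Definition r2 : word 'I_3 := wgen i2.

Definition R1 (s t : nat) : seq (word 'I_3) :=
  [:: r0 ^+ 2; r1 ^+ 2; r2 ^+ 2; (r0 * r1) ^+ (2 ^ s)%N;
      (r1 * r2) ^+ (2 ^ t)%N; (r0 * r2) ^+ 2;
      [~ (r0 * r1) ^+ 4, r2]; [~ r0, (r1 * r2) ^+ 4]]%W.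

Definition R2 (s t : nat) : seq (word 'I_3) :=
  [:: r0 ^+ 2; r1 ^+ 2; r2 ^+ 2; (r0 * r2) ^+ 2;
      (r0 * r1) ^+ (2 ^ s)%N; (r1 * r2) ^+ (2 ^ t)%N]%W.

(* Main.v *)
Require Import Defs.
From HB Require Import structures.
From mathcomp Require Import all_boot all_fingroup all_algebra.
From mathcomp Require Import cyclic generic_quotient boolp.
From mathcomp Require Import zify ring.

Set Implicit Arguments.
Unset Strict Implicit.
Unset Printing Implicit Defensive.

(** Write a, b, c for the three generators.  Each presentation is treated by
    exhibiting 2 ^ n words, the normal forms, with two properties: in every
    group satisfying the relators, each word in a, b, c has the value of some
    normal form; and in one concrete finite group satisfying the relators, the
    normal forms have pairwise distinct values.  The first property bounds the
    order of the presented group by 2 ^ n, the second bounds the order of the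
    concrete group from below, so the canonical map between them is an
    isomorphism ([map_of_normal_forms]).

    The normal forms come from abelian normal subgroups of rank two, which
    play the part of translation lattices.

    - If s + t = n, then x = abc and y = (ab)^2 commute, the commuting
      involutions a and c normalise <x, y>, and b = a x c.  Every element is
      x^i y^j a^e c^f ([normal_form_eq]).
    - If s = t and s + t > n, the same holds with x = ab and
      y = (ab)^2 (bc)^2, where b = a x ([normal_form_gt]).
    - If s + t < n, then p = (ab)^4 and q = (bc)^4 generate a normal subgroup.
      Modulo p and q the group is a quotient of the symmetry group of the
      square tessellation, where X = a bcb and Y = babc are the two unit
      translations and <b, c> is the stabiliser of a vertex.  Since
      [(ab)^2, c] = Y^2 and [(ab)^2, (bc)^2] = YXXY, the last relator says
      which translations are trivial, that is, on which torus the tessellation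
      is drawn: the translations X^k Y^l with k < 2^b1 and l < 2^b2 remain,
      where b1 = b2 or b2 = b1 + 1 according to the parity of n - s - t.
      Lifting back, every element is X^k Y^l b^e (bc)^J (ab)^(4i)
      ([normal_form_lt]).

    The concrete groups consist of affine permutations of a power of Z / 2^n,
    in which a cyclic group of order 2^r is embedded through its generator
    2^(n-r) ([step]).  The generators are read off from the action on the
    lattice above; in the case s + t < n two further coordinates carry the
    dihedral quotients of orders 2^(s+1) and 2^(t+1) obtained by killing c and
    a respectively, which is where p and q survive. *)

Import GroupScope.
Local Open Scope quotient_scope.

(** * Words and their values *)

Section Words.
Variable X : eqType.

Lemma wmulA : associative (@wmul X).
Proof. exact: catA. Qed.

Lemma winvK : involutive (@winv X).
Proof.
move=> u; rewrite /winv map_rev revK -map_comp map_id_in //.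
by move=> [x b] _ /=; rewrite negbK.
Qed.

End Words.

Section WordEval.
Variables (X : Type) (gT : groupType) (f : X -> gT).
Implicit Types u v : word X.

Lemma word_eval_gen x : word_eval f (wgen x) = f x.
Proof. by rewrite /word_eval /= mulg1. Qed.

Lemma word_eval_mul u v : word_eval f (u * v)%W = word_eval f u * word_eval f v.
Proof.
rewrite /wmul; elim: u => [|a u IHu] /=; first by rewrite mul1g.
by rewrite [LHS]/= -mulgA -IHu.
Qed.

Lemma word_eval_inv u : word_eval f (u^-1)%W = (word_eval f u)^-1.
Proof.
rewrite /winv; elim: u => [|[x b] u IHu] /=; first by rewrite invg1.
rewrite rev_cons -cats1 -/(wmul _ _) word_eval_mul IHu /= mulg1 invgM.
by case: b; rewrite /letter_eval /= ?invgK.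
Qed.

Lemma word_eval_exp u k : word_eval f (u ^+ k)%W = word_eval f u ^+ k.
Proof.
elim: k => [|k IHk] //.
by rewrite expgS -IHk -word_eval_mul.
Qed.

Lemma word_eval_comm u v :
  word_eval f [~ u, v]%W = commg (word_eval f u) (word_eval f v).
Proof.
by rewrite /wcomm !word_eval_mul !word_eval_inv commgEl conjgE !mulgA.
Qed.

Definition word_evalE :=
  (word_eval_comm, word_eval_exp, word_eval_inv, word_eval_mul, word_eval_gen).

End WordEval.

Definition satisfies (X : eqType) (R : seq (word X)) (gT : groupType)
  (f : X -> gT) := forall r, r \in R -> word_eval f r = 1.

Lemma satisfies_cons (X : eqType) (R : seq (word X)) r (gT : groupType)
    (f : X -> gT) :
  satisfies (r :: R) f <-> word_eval f r = 1 /\ satisfies R f.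
Proof.
split=> [fR|[fr fR] r']; last by rewrite inE => /predU1P[->|/fR].
by split=> [|r' r'R]; apply: fR; rewrite inE ?eqxx ?r'R ?orbT.
Qed.

Lemma pres_eq_sound (X : eqType) (R : seq (word X)) (gT : groupType)
    (f : X -> gT) u v :
  satisfies R f -> pres_eq R u v -> word_eval f u = word_eval f v.
Proof.
move=> fR; elim=> {u v} //.
- by move=> u v w _ -> _ ->.
- by move=> u u' v v' _ IHu _ IHv; rewrite !word_eval_mul IHu IHv.
- by move=> x []; rewrite /word_eval /letter_eval /= mulg1 ?mulgV ?mulVg.
Qed.

(** * The group defined by a presentation *)

Section PresentedGroup.
Variables (X : choiceType) (R : seq (word X)).

Definition pres_eqb (u v : word X) : bool := `[< pres_eq R u v >].

Fact pres_eqb_equiv : equiv_class_of pres_eqb.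
Proof.
split=> [u|u v|v u w].
- exact/asboolP/pres_refl.
- by apply/asboolP/asboolP; apply: pres_sym.
- by move=> /asboolP uv /asboolP vw; apply/asboolP/(pres_trans uv vw).
Qed.

Canonical pres_eqb_equiv_rel := EquivRelPack pres_eqb_equiv.

Definition pres_group := {eq_quot pres_eqb}.
HB.instance Definition _ := Choice.on pres_group.
HB.instance Definition _ := EqQuotient.on pres_group.

Local Notation cls := (\pi_(pres_group) : word X -> pres_group).

Lemma pres_clsP u v : cls u = cls v <-> pres_eq R u v.
Proof.
split; first by move/eqmodP/asboolP.
by move=> uv; apply/eqmodP/asboolP.
Qed.

Lemma pres_clsW (P : pres_group -> Prop) :
  (forall u, P (cls u)) -> forall x, P x.
Proof. exact: quotW. Qed.

Lemma pres_winvr u : pres_eq R (u * u^-1)%W [::].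
Proof.
rewrite /winv; elim: u => [|[x b] u IHu]; first exact: pres_refl.
rewrite /= rev_cons -cats1; set u' := rev _ in IHu *.
rewrite -[_ :: _]/([:: (x, b)] ++ (u ++ (u' ++ [:: (x, ~~ b)]))) (catA u).
apply: pres_trans (pres_cancel R x b).
exact: pres_mul (pres_refl R [:: _]) (pres_mul IHu (pres_refl R [:: _])).
Qed.

Lemma pres_winvl u : pres_eq R (u^-1 * u)%W [::].
Proof. by rewrite -{2}[u]winvK; apply: pres_winvr. Qed.

Lemma pres_winv u v : pres_eq R u v -> pres_eq R (u^-1)%W (v^-1)%W.
Proof.
move=> uv; have r w := pres_refl R w.
have vu := pres_mul (pres_mul (r u^-1%W) (pres_sym uv)) (r v^-1%W).
apply: (pres_trans _ (pres_trans vu (pres_mul (pres_winvl u) (r _)))).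
rewrite -wmulA -{1}[u^-1%W]cats0.
exact: pres_mul (r _) (pres_sym (pres_winvr v)).
Qed.

Definition pres_one : pres_group := cls [::].
Definition pres_mulg (x y : pres_group) : pres_group := cls (repr x * repr y)%W.
Definition pres_invg (x : pres_group) : pres_group := cls (repr x)^-1%W.

Lemma pres_repr u : pres_eq R (repr (cls u)) u.
Proof. by apply/pres_clsP; rewrite reprK. Qed.

Lemma pres_mulgE u v : pres_mulg (cls u) (cls v) = cls (u * v)%W.
Proof. by apply/pres_clsP/pres_mul; apply: pres_repr. Qed.

Lemma pres_invgE u : pres_invg (cls u) = cls u^-1%W.
Proof. by apply/pres_clsP/pres_winv/pres_repr. Qed.

Fact pres_mulgA : associative pres_mulg.
Proof.
elim/pres_clsW=> u; elim/pres_clsW=> v; elim/pres_clsW=> w.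
by rewrite !pres_mulgE /wmul catA.
Qed.

Fact pres_mul1g : left_id pres_one pres_mulg.
Proof. by elim/pres_clsW=> u; rewrite pres_mulgE. Qed.

Fact pres_mulg1 : right_id pres_one pres_mulg.
Proof. by elim/pres_clsW=> u; rewrite pres_mulgE /wmul cats0. Qed.

Fact pres_mulVg : left_inverse pres_one pres_invg pres_mulg.
Proof.
by elim/pres_clsW=> u; rewrite pres_invgE pres_mulgE; apply/pres_clsP/pres_winvl.
Qed.

Fact pres_mulgV : right_inverse pres_one pres_invg pres_mulg.
Proof.
by elim/pres_clsW=> u; rewrite pres_invgE pres_mulgE; apply/pres_clsP/pres_winvr.
Qed.

HB.instance Definition _ := isGroup.Build pres_group
  pres_mulgA pres_mul1g pres_mulg1 pres_mulVg pres_mulgV.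

Definition pres_gen (x : X) : pres_group := cls (wgen x).

Lemma pres_evalE u : word_eval pres_gen u = cls u.
Proof.
elim: u => [|[x b] u IHu] //=; rewrite IHu /letter_eval /=.
rewrite -[RHS](pres_mulgE [:: (x, b)] u); congr (_ * _).
by case: b => //=; rewrite /pres_gen; exact: pres_invgE.
Qed.

Lemma pres_evalP u v :
  word_eval pres_gen u = word_eval pres_gen v <-> pres_eq R u v.
Proof. by rewrite !pres_evalE; apply: pres_clsP. Qed.

Lemma pres_satisfies : satisfies R pres_gen.
Proof. by move=> r rR; apply/(pres_evalP r [::])/pres_rel. Qed.

End PresentedGroup.

(** The words that a presentation identifies differ by an element of any normal
    subgroup containing the relators.  Words that are equal modulo extra
    relators can thus be compared in a group where those relators do not hold.
    [P] need only be stable under conjugation by the values of words. *)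
Section Lift.
Variables (X : eqType) (R : seq (word X)) (H : groupType) (h : X -> H).
Variable P : H -> Prop.
Hypotheses (PM : forall x y, P x -> P y -> P (x * y)).
Hypotheses (PV : forall x, P x -> P x^-1).
Hypotheses (PJ : forall x v, P x -> P (x ^ word_eval h v)).
Hypotheses (P1 : P 1).
Hypothesis PR : forall r, r \in R -> P (word_eval h r).

Lemma eval_mod_normal w w' :
  pres_eq R w w' -> P ((word_eval h w')^-1 * word_eval h w).
Proof.
elim=> {w w'}.
- by move=> u; rewrite mulVg.
- by move=> u v _ /PV; rewrite invgM invgK.
- by move=> u v w _ IHu _ IHv; have := PM IHv IHu; rewrite mulgA mulgK.
- move=> u u' v v' _ IHu _ IHv; rewrite !word_eval_mul.
  have := PM (PJ v' IHu) IHv.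
  by rewrite conjgE invgM -!mulgA mulKVg.
- move=> x []; rewrite /word_eval /letter_eval /= mulg1 ?mulgV ?mulVg;
  by rewrite ?mulg1 ?invg1.
- by move=> r rR; rewrite /= invg1 mul1g; exact: PR.
Qed.

End Lift.

(** * Regular maps from normal forms *)

Section NormalForms.
Variables (gT : finGroupType) (f : 'I_3 -> gT) (R : seq (word 'I_3)).
Variables (I : finType) (nf : I -> word 'I_3).
Hypothesis fR : satisfies R f.
Hypothesis f_order2 : forall i, #[f i] = 2.
Hypothesis f02_order2 : #[f i0 * f i2] = 2.
Hypothesis nf_inj : injective (fun i => word_eval f (nf i)).
Hypothesis nf_cover : forall (H : groupType) (h : 'I_3 -> H), satisfies R h ->
  forall w, exists i, word_eval h w = word_eval h (nf i).

Let G := <<[set f i | i in 'I_3]>>%G.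
Let fG i : f i \in G. Proof. by apply: mem_gen; apply: imset_f. Qed.
Let rhoG (i : 'I_3) : subg_of G := subg G (f i).

Let sgval_eval w : sgval (word_eval rhoG w) = word_eval f w.
Proof.
elim: w => [|[x b] w IHw] //=; rewrite IHw; congr (_ * _).
by case: b; rewrite /letter_eval /= subgK.
Qed.

Let rhoG_gen : <<[set rhoG i | i in 'I_3]>> = [set: subg_of G].
Proof.
apply: (injm_morphim_inj (injm_sgval G)); rewrite ?subsetT //.
rewrite morphim_gen ?subsetT // morphimEsub ?subsetT // -imset_comp.
rewrite im_sgval; congr <<_>>.
by apply: eq_imset => i /=; rewrite subgK.
Qed.

(** Normal forms that suffice in the presented group and are told apart by [f]
    make the map from the presented group to the group generated by the values
    of [f] injective: two words with equal values are equivalent to the same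
    normal form. *)
Lemma map_of_normal_forms : exists M : regular_map,
  [/\ map_order M = #|I|, map_type M #[f i0 * f i1] #[f i1 * f i2]
    & Aut_presented_by M R].
Proof.
have ordG (x : subg_of G) : #[sgval x] = #[x].
  by rewrite (order_injm (injm_sgval G)) ?inE.
have r2 i : #[rhoG i] = 2 by rewrite -ordG subgK.
have rM i j : #[rhoG i * rhoG j] = #[f i * f j] by rewrite -ordG /= !subgK.
have pres_nf w : exists i, pres_eq R w (nf i).
  have [i /pres_evalP wi] := nf_cover (@pres_satisfies _ R) w.
  by exists i.
have evalW g : exists w, word_eval rhoG w = g.
  have : g \in <<[set rhoG i | i in 'I_3]>> by rewrite rhoG_gen inE.
  case/gen_prodgP=> k [c cP ->]; elim: k c cP => [|k IHk] c cP.
    by exists [::]; rewrite big_ord0.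
  have [i _ ci] := imsetP (cP ord0).
  have [w Ew] := IHk (fun j => c (lift ord0 j)) (fun j => cP _).
  exists (wgen i * w)%W.
  by rewrite big_ord_recl -Ew word_eval_mul word_eval_gen ci.
have inj i j : word_eval rhoG (nf i) = word_eval rhoG (nf j) -> i = j.
  by move/(congr1 sgval); rewrite !sgval_eval; apply: nf_inj.
have sat : satisfies R rhoG.
  by move=> r rR; apply: val_inj; rewrite /= sgval_eval fR.
exists (RegularMap rhoG_gen r2 (etrans (rM i0 i2) f02_order2)); split.
- rewrite /map_order /= -(card_imset _ inj) -cardsT; apply: eq_card => g.
  rewrite inE; apply/esym/imsetP; have [w <-] := evalW g.
  by have [i wi] := pres_nf w; exists i => //; apply: pres_eq_sound wi.
- by split; exact: rM.
split=> //= u v; split=> [uv|]; last exact: pres_eq_sound.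
have [i ui] := pres_nf u; have [j vj] := pres_nf v.
have ij : i = j.
  by apply: inj; rewrite -(pres_eq_sound sat ui) -(pres_eq_sound sat vj).
by apply: pres_trans ui _; rewrite ij; apply: pres_sym.
Qed.

End NormalForms.

(** * Groups generated by involutions *)

Lemma ord3_ind (P : 'I_3 -> Prop) : P i0 -> P i1 -> P i2 -> forall i, P i.
Proof.
by move=> P0 P1 P2 [[|[|[|//]]] lti]; rewrite (bool_irrelevance lti isT).
Qed.

Section GroupTypeExtras.
Variable H : groupType.
Implicit Types g h x y : H.

Lemma invol_inv g : g * g = 1 -> g^-1 = g.
Proof. exact: mulg1_eq. Qed.

Lemma invol_conjE g x : g * g = 1 -> x ^ g = g * x * g.
Proof. by move=> gg; rewrite conjgE (invol_inv gg) mulgA. Qed.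

Lemma invol_mulC g x : g * g = 1 -> g * x = x ^ g * g.
Proof. by move=> gg; rewrite invol_conjE // -!mulgA gg mulg1. Qed.

Lemma conjg_fix_commute x y : x ^ y = x -> commute x y.
Proof. by rewrite /commute conjgC => ->. Qed.

Lemma commute_conjg x y : commute x y -> x ^ y = x.
Proof. by move=> cxy; rewrite conjgE cxy mulKg. Qed.

Lemma expg_modn x m k : x ^+ m = 1 -> x ^+ k = x ^+ (k %% m).
Proof.
by move=> xm; rewrite {1}(divn_eq k m) expgnDr mulnC expgnA xm expg1n mul1g.
Qed.

Lemma invg_exp x m : 0 < m -> x ^+ m = 1 -> x^-1 = x ^+ m.-1.
Proof. by move=> m0 xm; apply: mulg1_eq; rewrite -expgS prednK. Qed.

Lemma invol_mul_invol g h : g * g = 1 -> h * h = 1 -> h * g = g * h ->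
  g * h * (g * h) = 1.
Proof. by move=> gg hh hg; rewrite -mulgA (mulgA h) hg -!mulgA hh mulg1. Qed.

Lemma rotation_conj g h : g * g = 1 -> h * h = 1 ->
  (g * h) ^ g = (g * h)^-1 /\ (g * h) ^ h = (g * h)^-1.
Proof.
move=> gg hh; rewrite !conjgE invgM !invol_inv // -!mulgA hh mulg1.
by rewrite !mulgA gg mul1g.
Qed.

Lemma rotation4_swap g h : g * g = 1 -> h * h = 1 -> (g * h) ^+ 4 = 1 ->
  g * (h * (g * h)) = h * (g * (h * g)).
Proof.
move=> gg hh; rewrite (expgnDr _ 2 2) => /mulg1_eq.
by rewrite expg2 !invgM !invol_inv // -!mulgA.
Qed.

(** The generators being involutions, left multiplication by them reaches every
    value of a word. *)
Lemma eval_invol_ind (X : Type) (f : X -> H) (S : H -> Prop) :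
    (forall i, f i * f i = 1) -> S 1 -> (forall i h, S h -> S (f i * h)) ->
  forall w, S (word_eval f w).
Proof.
move=> ff S1 Sf; elim=> [|[i b] w IHw] //=.
by case: b; rewrite /letter_eval /= ?(invol_inv (ff i)); apply: Sf.
Qed.

(** A product set [L K] is stable under left multiplication by an involution [g]
    as soon as [g] normalises [L] and sends [K] into [L K]. *)
Lemma factor_closed (L K : H -> Prop) g :
    g * g = 1 -> (forall x y, L x -> L y -> L (x * y)) ->
    (forall x, L x -> L (x ^ g)) ->
    (forall k, K k -> exists x k', [/\ L x, K k' & g * k = x * k']) ->
  forall h, (exists x k, [/\ L x, K k & h = x * k]) ->
  exists x k, [/\ L x, K k & g * h = x * k].
Proof.
move=> gg LM LJ LK h [x [k [Lx Kk ->]]].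
have [y [k' [Ly Kk' gk]]] := LK k Kk.
exists (x ^ g * y), k'; split=> //; first exact: LM (LJ x Lx) Ly.
by rewrite mulgA (invol_mulC x gg) -!mulgA gk.
Qed.

End GroupTypeExtras.

(** * Abelian subgroups of rank two *)

(** Natural exponents suffice to describe the subgroup generated by two commuting
    elements, since both have finite order in all uses. *)
Definition rank2_span (H : groupType) (x y h : H) : Prop :=
  exists i j, h = x ^+ i * y ^+ j.

Section Rank2.
Variables (H : groupType) (x y : H) (m q r : nat).
Hypotheses (cxy : commute x y) (m0 : 0 < m) (r0 : 0 < r).
Hypotheses (xm : x ^+ m = y ^+ q) (yr : y ^+ r = 1).

Lemma rank2_1 : rank2_span x y 1.
Proof. by exists 0%N, 0%N; rewrite mulg1. Qed.

Lemma rank2_l : rank2_span x y x.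
Proof. by exists 1%N, 0%N; rewrite mulg1. Qed.

Lemma rank2_r : rank2_span x y y.
Proof. by exists 0%N, 1%N; rewrite mul1g. Qed.

Lemma rank2M g h :
  rank2_span x y g -> rank2_span x y h -> rank2_span x y (g * h).
Proof.
move=> [i [j ->]] [k [l ->]]; exists (i + k), (j + l).
rewrite !expgnDr !mulgA; congr (_ * _); rewrite -!mulgA; congr (_ * _).
exact/commute_sym/commuteX2.
Qed.

Lemma rank2X g k : rank2_span x y g -> rank2_span x y (g ^+ k).
Proof.
move=> Lg; elim: k => [|k IHk]; first exact: rank2_1.
by rewrite expgS; apply: rank2M.
Qed.

Lemma rank2V g : rank2_span x y g -> rank2_span x y g^-1.
Proof.
have xmr : x ^+ (m * r) = 1 by rewrite expgnA xm expgnAC yr expg1n.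
move=> [i [j ->]]; rewrite invgM -!expVgn.
rewrite (invg_exp r0 yr) (invg_exp _ xmr) ?muln_gt0 ?m0 //.
by apply: rank2M; do 2!apply: rank2X; [apply: rank2_r | apply: rank2_l].
Qed.

Lemma rank2J g : rank2_span x y (x ^ g) -> rank2_span x y (y ^ g) ->
  forall h, rank2_span x y h -> rank2_span x y (h ^ g).
Proof.
move=> Lx Ly _ [i [j ->]]; rewrite conjMg !conjXg.
by apply: rank2M; apply: rank2X.
Qed.

(** The relation [x ^+ m = y ^+ q] lets the power of [y] absorb the quotient of
    the exponent of [x] by [m]. *)
Lemma rank2_reduce h : rank2_span x y h ->
  exists i j, [/\ i < m, j < r & h = x ^+ i * y ^+ j].
Proof.
move=> [i [j ->]]; exists (i %% m), ((q * (i %/ m) + j) %% r).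
rewrite !ltn_mod; split=> //.
rewrite -(expg_modn _ yr) {1}(divn_eq i m) addnC expgnDr (mulnC _ m) expgnA xm.
by rewrite -expgnA -mulgA -expgnDr.
Qed.

End Rank2.

(** ** Extensions by two commuting involutions *)

Section KleinTop.
Variables (H : groupType) (a c x y : H) (m q r : nat).
Hypotheses (aa : a * a = 1) (cc : c * c = 1) (ca : c * a = a * c).
Hypotheses (cxy : commute x y) (m0 : 0 < m) (r0 : 0 < r).
Hypotheses (xm : x ^+ m = y ^+ q) (yr : y ^+ r = 1).
Local Notation L := (rank2_span x y).
Hypotheses (xa : L (x ^ a)) (ya : L (y ^ a)) (xc : L (x ^ c)) (yc : L (y ^ c)).

Local Notation K := (fun k => exists e f : bool, k = a ^+ e * c ^+ f).
Definition klein_form h := exists l k, [/\ L l, K k & h = l * k].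

Lemma klein_form1 : klein_form 1.
Proof.
exists 1, 1; rewrite mul1g; split=> //; first exact: rank2_1.
by exists false, false; rewrite mul1g.
Qed.

Lemma klein_form_a h : klein_form h -> klein_form (a * h).
Proof.
apply: factor_closed => //; first exact: rank2M.
  exact: rank2J.
move=> _ [e [f ->]]; exists 1, (a ^+ (~~ e) * c ^+ f).
rewrite mul1g mulgA; split; [exact: rank2_1 | by exists (~~ e), f |].
by case: e; rewrite /= ?mulg1 ?expg1 ?aa.
Qed.

Lemma klein_form_c h : klein_form h -> klein_form (c * h).
Proof.
apply: factor_closed => //; first exact: rank2M.
  exact: rank2J.
move=> _ [e [f ->]]; exists 1, (a ^+ e * c ^+ (~~ f)).
rewrite mul1g mulgA; split; [exact: rank2_1 | by exists e, (~~ f) |].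
by case: e; case: f; rewrite /= ?ca ?mulg1 ?mul1g ?expg1 -?mulgA ?cc ?mulg1.
Qed.

Lemma klein_form_l g h : L g -> klein_form h -> klein_form (g * h).
Proof.
move=> Lg [l [k [Ll Kk ->]]]; exists (g * l), k; rewrite mulgA; split=> //.
exact: rank2M.
Qed.

Lemma klein_form_reduce h : klein_form h ->
  exists i j (e f : bool),
    [/\ i < m, j < r & h = x ^+ i * y ^+ j * a ^+ e * c ^+ f].
Proof.
move=> [l [k [Ll [e [f ->]] ->]]].
have [i [j [im jr ->]]] := rank2_reduce m0 r0 xm yr Ll.
by exists i, j, e, f; split=> //; rewrite !mulgA.
Qed.

(** The normal forms of the cases s + t >= n: a lattice <x, y> normalised by [a]
    and [c], with the remaining generator expressed through [a], the lattice and
    [c]. *)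
Lemma klein_cover (f : 'I_3 -> H) l (g : bool) :
    f i0 = a -> f i2 = c -> f i1 = a * l * c ^+ g -> f i1 * f i1 = 1 -> L l ->
  forall w, exists i j (e k : bool),
    [/\ i < m, j < r & word_eval f w = x ^+ i * y ^+ j * a ^+ e * c ^+ k].
Proof.
move=> fa fc fb bb Ll w; apply: klein_form_reduce.
apply: eval_invol_ind w; [|exact: klein_form1|].
  by apply: ord3_ind; rewrite ?fa ?fc.
apply: ord3_ind => h Kh; rewrite ?fa ?fb ?fc; last exact: klein_form_c.
  exact: klein_form_a.
rewrite -!mulgA; apply/klein_form_a/klein_form_l => //.
by case: g {fb} => /=; rewrite ?mul1g //; apply: klein_form_c.
Qed.

End KleinTop.

(** * Relations as identities in a group *)

Definition reflections (gT : groupType) (a b c : gT) (s t : nat) :=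
  [/\ a * a = 1, b * b = 1, c * c = 1, c * a = a * c
   & (a * b) ^+ (2 ^ s)%N = 1 /\ (b * c) ^+ (2 ^ t)%N = 1].

Section SatisfiesE.
Variables (gT : groupType) (f : 'I_3 -> gT).
Local Notation a := (f i0).
Local Notation b := (f i1).
Local Notation c := (f i2).

Lemma ac_commuteE : a * a = 1 -> c * c = 1 ->
  ((a * c) ^+ 2 = 1 <-> c * a = a * c).
Proof.
move=> aa cc; rewrite expg2; split=> [/mulg1_eq|ca].
  by rewrite invgM !invol_inv.
exact: invol_mul_invol.
Qed.

Lemma satisfies_R2 s t E :
  satisfies (R2 s t ++ E) f <-> reflections a b c s t /\ satisfies E f.
Proof.
rewrite /R2 !cat_cons cat0s !satisfies_cons !word_evalE !expg2.
split=> [[aa [bb [cc [ac [abs [bct fE]]]]]]|[[aa bb cc ca [abs bct]] fE]].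
  by split=> //; split=> //; apply/(ac_commuteE aa cc); rewrite expg2.
by do !split=> //; rewrite -expg2; apply/(ac_commuteE aa cc).
Qed.

Lemma satisfies_R1 s t E :
  satisfies (R1 s t ++ E) f <->
  [/\ reflections a b c s t, commute ((a * b) ^+ 4) c,
      commute ((b * c) ^+ 4) a & satisfies E f].
Proof.
have commE (x y : gT) : commg x y = 1 <-> commute x y.
  by split=> [/eqP/commgP|/commgP/eqP].
rewrite /R1 !cat_cons cat0s !satisfies_cons !word_evalE !commE !expg2.
split=> [[aa [bb [cc [abs [bct [ac [abc [bca fE]]]]]]]]|
         [[aa bb cc ca [abs bct]] abc /commute_sym bca fE]].
  split=> //; split=> //.
  by apply/(ac_commuteE aa cc); rewrite expg2.
by do !split=> //; rewrite -expg2; apply/(ac_commuteE aa cc).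
Qed.
End SatisfiesE.

(** ** Identities between words *)

Section WordIdentities.
Variables (H : groupType) (a b c : H).
Hypotheses (aa : a * a = 1) (bb : b * b = 1) (cc : c * c = 1).
Hypothesis ca : c * a = a * c.

Let aK x : a * (a * x) = x. Proof. by rewrite mulgA aa mul1g. Qed.
Let bK x : b * (b * x) = x. Proof. by rewrite mulgA bb mul1g. Qed.
Let cK x : c * (c * x) = x. Proof. by rewrite mulgA cc mul1g. Qed.
Let caK x : c * (a * x) = a * (c * x). Proof. by rewrite mulgA ca mulgA. Qed.
Let mAr x y z : x * y * z = x * (y * z) :> H. Proof. by rewrite mulgA. Qed.
Let aV : a^-1 = a := invol_inv aa.
Let bV : b^-1 = b := invol_inv bb.
Let cV : c^-1 = c := invol_inv cc.

Local Notation u := ((a * b) ^+ 2).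
Local Notation v := ((b * c) ^+ 2).
(* Rewriting by these rules brings a word to the form where no two equal letters
   are adjacent and ca does not occur.  This decides equality in the Coxeter
   group where a and c commute and ab, bc have infinite order. *)
Local Notation simpw :=
  (@expg2 H, @conjgE H, @invgM H, aV, bV, cV, mAr, aK, bK, cK, caK,
   aa, bb, cc, ca, @mulg1 H).

Lemma sqr_ab_conj_a : u ^ a = u^-1. Proof. by rewrite !simpw. Qed.
Lemma sqr_ab_conj_b : u ^ b = u^-1. Proof. by rewrite !simpw. Qed.
Lemma sqr_bc_conj_b : v ^ b = v^-1. Proof. by rewrite !simpw. Qed.
Lemma sqr_bc_conj_c : v ^ c = v^-1. Proof. by rewrite !simpw. Qed.

Lemma abc_sqr : (a * b * c) ^+ 2 = u * v.
Proof. by rewrite !simpw. Qed.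

Lemma ab_conj_a : (a * b) ^ a = (a * b)^-1. Proof. by rewrite !simpw. Qed.
Lemma ab_conj_c : (a * b) ^ c = a * b * v. Proof. by rewrite !simpw. Qed.
Lemma abc_conj_c : (a * b * c) ^ c = (a * b * c)^-1 * u.
Proof. by rewrite !simpw. Qed.

Lemma abc_conj_a : (a * b * c) ^ a = u^-1 * (a * b * c).
Proof. by rewrite !simpw. Qed.

(** What makes <ab, (ab)^2 (bc)^2> abelian when s + t > n: conjugation by [c]
    shears (ab)^2, and this alone forces [a] to invert (bc)^2. *)
Lemma sqr_bc_conj_a : u ^ c = u * v ^+ 2 -> v ^ a = v^-1.
Proof.
move=> uc; have -> : v ^ a = (u * b * c) ^+ 2 by rewrite !simpw.
have -> : (u * b * c) ^+ 2 = u * b * u ^ c * (c * b * c) by rewrite !simpw.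
by rewrite uc !simpw.
Qed.

(** In the symmetry group of the square tessellation with a vertex at the origin,
    [b] exchanges the coordinates, [c] negates the second one and [a] reflects
    the first one in 1/2; the words [X] and [Y] are unit translations. *)
Section TorusIdentities.
Local Notation X := (a * (b * c * b)).
Local Notation Y := (b * a * b * c).

Lemma trX_conj_b : X ^ b = Y. Proof. by rewrite !simpw. Qed.
Lemma trX_conj_a : X ^ a = X^-1. Proof. by rewrite !simpw. Qed.
Lemma commg_sqr_ab_c : commg u c = Y ^+ 2. Proof. by rewrite commgEl !simpw. Qed.
Lemma commg_sqr_ab_sqr_bc : commg u v = Y * X * (X * Y).
Proof. by rewrite commgEl !simpw. Qed.

(* (ab)^4 = 1 and (bc)^4 = 1, oriented as rewrite rules. *)
Hypotheses (abab : a * (b * (a * b)) = b * (a * (b * a))).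
Hypotheses (bcbc : c * (b * (c * b)) = b * (c * (b * c))).
Let ababK x : a * (b * (a * (b * x))) = b * (a * (b * (a * x))).
Proof. by have := congr1 (fun z => z * x) abab; rewrite -!mulgA. Qed.
Let bcbcK x : c * (b * (c * (b * x))) = b * (c * (b * (c * x))).
Proof. by have := congr1 (fun z => z * x) bcbc; rewrite -!mulgA. Qed.

Lemma trX_trY_commute : commute X Y.
Proof. by rewrite /commute !(simpw, abab, bcbc, ababK, bcbcK). Qed.
Lemma trY_conj_a : Y ^ a = Y.
Proof. by rewrite !(simpw, abab, bcbc, ababK, bcbcK). Qed.
Lemma trX_conj_c : X ^ c = X.
Proof. by rewrite !(simpw, abab, bcbc, ababK, bcbcK). Qed.
Lemma trY_conj_c : Y ^ c = Y^-1.
Proof. by rewrite !(simpw, abab, bcbc, ababK, bcbcK). Qed.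
End TorusIdentities.

End WordIdentities.

(** * Normal forms *)

(** ** The case s + t = n *)

Definition relators_eq s t : seq (word 'I_3) :=
  (R2 s t ++ [:: [~ (r0 * r1) ^+ 2, r2];
     (r0 * r1) ^+ (2 ^ (s - 1))%N * (r1 * r2) ^+ (2 ^ (t - 1))%N])%W.

Lemma normal_form_eq s t (H : groupType) (f : 'I_3 -> H) :
    2 <= s -> 2 <= t -> satisfies (relators_eq s t) f ->
  forall w, exists i j (e g : bool),
    [/\ i < 2 ^ (t - 1), j < 2 ^ (s - 1) &
        word_eval f w = (f i0 * f i1 * f i2) ^+ i * ((f i0 * f i1) ^+ 2) ^+ j
                          * f i0 ^+ e * f i2 ^+ g].
Proof.
move=> s2 t2 /satisfies_R2[[aa bb cc ca [abs bct]]].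
rewrite !satisfies_cons !word_evalE => -[/eqP/commgP cuc [rel _]].
set a := f i0 in aa abs ca rel cuc *; set b := f i1 in bb abs bct rel cuc *.
set c := f i2 in cc ca bct rel cuc *.
set u := (a * b) ^+ 2 in cuc *; set tau := a * b * c.
have ua : u ^ a = u^-1 by exact: sqr_ab_conj_a.
have ub : u ^ b = u^-1 by exact: sqr_ab_conj_b.
have uc : u ^ c = u by apply: commute_conjg.
have ctu : commute tau u.
  by apply/commute_sym/conjg_fix_commute; rewrite !conjgM ua conjVg ub invgK uc.
have cuv : commute u ((b * c) ^+ 2).
  apply: conjg_fix_commute.
  by rewrite expg2 !conjgM ub conjVg uc conjVg ub invgK uc.
have p2 k : 2 <= k -> (2 ^ (k - 1) = 2 * 2 ^ (k - 2))%N.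
  by move=> k2; rewrite -expnS; congr (2 ^ _)%N; lia.
have ur : u ^+ (2 ^ (s - 1)) = 1.
  rewrite -expgnA -expnS subn1 prednK //; lia.
have tm : tau ^+ (2 ^ (t - 1)) = u ^+ (2 ^ (t - 2) + 2 ^ (s - 2)).
  rewrite p2 // expgnA (abc_sqr bb ca) expgMn // expgnDr; congr (_ * _).
  rewrite -!expgnA -!p2 //; apply: (mulgI ((a * b) ^+ (2 ^ (s - 1)))).
  rewrite rel -expgnDr addnn -mul2n -expnS subn1 prednK //; lia.
have m0 k : 0 < 2 ^ k by rewrite expn_gt0.
have L1 := rank2_l tau u; have L2 := rank2_r tau u.
have LV := rank2V ctu (m0 (t - 1)) (m0 (s - 1)) tm ur.
have ta : tau ^ a = tau * u^-1.
  by rewrite (abc_conj_a aa bb ca); apply/commute_sym/commuteV.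
have tc : tau ^ c = tau^-1 * u by exact: abc_conj_c.
apply: (klein_cover aa cc ca ctu (m0 _) (m0 _) tm ur
          _ _ _ _ _ _ _ bb L1 (g := true)) => //.
- by rewrite ta; apply: rank2M => //; apply: LV.
- by rewrite ua; apply: LV.
- by rewrite tc; apply: rank2M => //; apply: LV.
- by rewrite uc.
- by rewrite /tau !mulgA aa mul1g -[RHS]mulgA [c * _]cc mulg1.
Qed.

(** ** The case s = t, s + t > n *)

Definition relators_gt n s t : seq (word 'I_3) :=
  (R2 s t ++ [:: (r0 * r1) ^+ (2 ^ (n - t - 1))%N
                   * (r1 * r2) ^+ (2 ^ (n - t - 1))%N;
                 [~ (r0 * r1) ^+ 2, r2] * (r2 * r1) ^+ 4])%W.

Lemma normal_form_gt n t (H : groupType) (f : 'I_3 -> H) :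
    2 <= t <= n - 2 -> satisfies (relators_gt n t t) f ->
  forall w, exists i j (e g : bool),
    [/\ i < 2 ^ t, j < 2 ^ (n - t - 2) &
        word_eval f w = (f i0 * f i1) ^+ i
                          * ((f i0 * f i1) ^+ 2 * (f i1 * f i2) ^+ 2) ^+ j
                          * f i0 ^+ e * f i2 ^+ g].
Proof.
move=> /andP[t2 tn] /satisfies_R2[[aa bb cc ca [xt _]]].
rewrite !satisfies_cons !word_evalE => -[rel [/mulg1_eq cuc _]].
set a := f i0 in aa xt ca rel cuc *; set b := f i1 in bb xt rel cuc *.
set c := f i2 in cc ca rel cuc *.
set x := a * b in xt rel cuc *; set v := (b * c) ^+ 2; set w := x ^+ 2 * v.
have ua : (x ^+ 2) ^ a = (x ^+ 2)^-1 by exact: sqr_ab_conj_a.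
have xa : x ^ a = x^-1 by exact: ab_conj_a.
have vb : v ^ b = v^-1 by exact: sqr_bc_conj_b.
have vc : v ^ c = v^-1 by exact: sqr_bc_conj_c.
have uc : (x ^+ 2) ^ c = x ^+ 2 * v ^+ 2.
  apply: (canRL (mulKVg _)); rewrite -commgEl -[LHS]invgK cuc.
  by rewrite -expVgn invgM !invol_inv // /v -expgnA.
have va : v ^ a = v^-1 by exact: sqr_bc_conj_a uc.
have cxv : commute x v.
  apply/commute_sym/conjg_fix_commute.
  by rewrite conjgM va conjVg vb invgK.
have cxw : commute x w by apply: commuteM => //; apply: commuteX.
have xc : x ^ c = x^-1 * w.
  by rewrite (ab_conj_c bb cc ca) -/x -/v /w (expg2 x) -(mulgA x) mulKg.
have wc : w ^ c = w by rewrite conjMg uc vc -mulgA expg2 mulgK.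
have wa : w ^ a = w^-1.
  rewrite conjMg ua va -invgM; congr (_^-1).
  exact/commuteX/commute_sym.
have xm : x ^+ (2 ^ t) = w ^+ 0 by [].
have wr : w ^+ (2 ^ (n - t - 2)) = 1.
  rewrite expgMn; last exact/commute_sym/commuteX/commute_sym.
  by rewrite -!expgnA -expnS -[RHS]rel; congr (_ ^+ (2 ^ _) * _ ^+ (2 ^ _)); lia.
have m0 k : 0 < 2 ^ k by rewrite expn_gt0.
have L1 := rank2_l x w; have L2 := rank2_r x w.
have LV := rank2V cxw (m0 t) (m0 _) xm wr.
apply: (klein_cover aa cc ca cxw (m0 _) (m0 _) xm wr
          _ _ _ _ _ _ _ bb L1 (g := false)) => //.
- by rewrite xa; apply: LV.
- by rewrite wa; apply: LV.
- by rewrite xc; apply: rank2M => //; apply: LV.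
- by rewrite wc.
- by rewrite /x /= mulg1 mulgA aa mul1g.
Qed.

(** ** The case s + t < n *)

Definition word_trX : word 'I_3 := (r0 * (r1 * r2 * r1))%W.
Definition word_trY : word 'I_3 := (r1 * r0 * r1 * r2)%W.

(** The consequence of the last relator on the translations of the tessellation.
    The two parities of n - s - t are treated alike through this form: the
    translation group is <X, Y> modulo X^B1 Y^B1 and Y^B2, of order B1 B2. *)
Definition torus_relator (E : word 'I_3) (B1 B2 : nat) : Prop :=
  forall (K : groupType) (f : 'I_3 -> K),
    f i0 * f i0 = 1 -> f i1 * f i1 = 1 -> f i2 * f i2 = 1 ->
    f i2 * f i0 = f i0 * f i2 ->
    (f i0 * f i1) ^+ 4 = 1 -> (f i1 * f i2) ^+ 4 = 1 -> word_eval f E = 1 ->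
  word_eval f word_trX ^+ B1 * word_eval f word_trY ^+ B1 = 1
  /\ word_eval f word_trY ^+ B2 = 1.

Section TorusCover.
Variables (K : groupType) (f : 'I_3 -> K) (B1 B2 : nat).
Local Notation a := (f i0).
Local Notation b := (f i1).
Local Notation c := (f i2).
Local Notation X := (a * (b * c * b)).
Local Notation Y := (b * a * b * c).
Hypotheses (aa : a * a = 1) (bb : b * b = 1) (cc : c * c = 1).
Hypothesis ca : c * a = a * c.
Hypotheses (ab4 : (a * b) ^+ 4 = 1) (bc4 : (b * c) ^+ 4 = 1).
Hypotheses (B1_gt0 : 0 < B1) (B2_gt0 : 0 < B2).
Hypotheses (XYB : X ^+ B1 * Y ^+ B1 = 1) (YB : Y ^+ B2 = 1).

(** Translations times the stabiliser <b, c> of the vertex at the origin. *)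
Lemma torus_normal_form w : exists k l (e : bool) j,
  [/\ k < B1, l < B2, j < 4
    & word_eval f w = X ^+ k * Y ^+ l * (b ^+ e * (b * c) ^+ j)].
Proof.
have abab := rotation4_swap aa bb ab4.
have cbcb : c * (b * (c * b)) = b * (c * (b * c)).
  by rewrite -(rotation4_swap bb cc bc4).
have bK z : b * (b * z) = z by rewrite mulgA bb mul1g.
have cK z : c * (c * z) = z by rewrite mulgA cc mul1g.
have cXY : commute X Y by exact: trX_trY_commute.
have Xm : X ^+ B1 = Y ^+ (B2.-1 * B1).
  by rewrite expgnA -(invg_exp B2_gt0 YB) expVgn -[LHS]invgK (mulg1_eq XYB).
have L1 := rank2_l X Y; have L2 := rank2_r X Y.
have LV := rank2V cXY B1_gt0 B2_gt0 Xm YB.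
pose D d := exists (e : bool) j, d = b ^+ e * (b * c) ^+ j.
have Db d : D d -> D (b * d).
  move=> [e [j ->]]; exists (~~ e), j; rewrite mulgA; congr (_ * _).
  by case: e; rewrite /= ?bb ?mulg1.
have Dc d : D d -> D (c * d).
  move=> [[] [j ->]].
    exists false, (3 + j)%N; rewrite /= mul1g expgnDr mulgA; congr (_ * _).
    by rewrite -(invg_exp _ bc4) // invgM !invol_inv.
  by exists true, j.+1; rewrite (expgS _ j) !mulgA !expg1 bb expg0 !mulg1 mul1g.
pose S h := exists l d, [/\ rank2_span X Y l, D d & h = l * d].
have Sl g h : rank2_span X Y g -> S h -> S (g * h).
  move=> Lg [l [d [Ll Dd ->]]]; exists (g * l), d.
  by split; [exact: rank2M | | exact: mulgA].
have Yb : Y ^ b = X by rewrite -(trX_conj_b a c bb) -conjgM bb conjg1.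
have Sb h : S h -> S (b * h).
  apply: factor_closed => //; first exact: rank2M.
    by apply: rank2J => //; rewrite ?(trX_conj_b a c bb) ?Yb.
  by move=> d Dd; exists 1, (b * d); rewrite mul1g; split=> //;
    [exact: rank2_1 | exact: Db].
have Sc h : S h -> S (c * h).
  apply: factor_closed => //; first exact: rank2M.
    apply: rank2J => //; first by rewrite (trX_conj_c cc ca cbcb).
    by rewrite (trY_conj_c aa bb cc); apply: LV.
  by move=> d Dd; exists 1, (c * d); rewrite mul1g; split=> //;
    [exact: rank2_1 | exact: Dc].
have Sa h : S h -> S (a * h).
  move=> Sh; have -> : a * h = X * (b * (c * (b * h))).
    by rewrite -!mulgA bK cK bK.
  by apply: Sl => //; apply/Sb/Sc/Sb.
have : S (word_eval f w).
  apply: eval_invol_ind w; [exact: ord3_ind | | exact: ord3_ind].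
  exists 1, 1; rewrite mul1g; split=> //; first exact: rank2_1.
  by exists false, 0%N; rewrite mul1g.
move=> [l [_ [Ll [e [j ->]] ->]]].
have [k [i [kB iB ->]]] := rank2_reduce B1_gt0 B2_gt0 Xm YB Ll.
by exists k, i, e, (j %% 4); rewrite ltn_mod -expg_modn.
Qed.
End TorusCover.

Definition word_lt (k l e J i : nat) : word 'I_3 :=
  (word_trX ^+ k * word_trY ^+ l * (r1 ^+ e * (r1 * r2) ^+ J)
     * (r0 * r1) ^+ (4 * i))%W.

(** The normal forms of the tessellation group, corrected by an element of the
    normal subgroup <(ab)^4, (bc)^4>; its factor (bc)^(4j) merges with the power
    of bc already present. *)
Lemma normal_form_lt s t E B1 B2 (H : groupType) (f : 'I_3 -> H) :
    2 <= s -> 2 <= t -> 0 < B1 -> 0 < B2 -> torus_relator E B1 B2 ->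
    satisfies (R1 s t ++ [:: E]) f ->
  forall w, exists k l (e : bool) J i,
    [/\ k < B1, l < B2, J < 2 ^ t, i < 2 ^ (s - 2) &
        word_eval f w = word_eval f (word_lt k l e J i)].
Proof.
move=> s2 t2 B1_gt0 B2_gt0 torE fsat w.
have /satisfies_R1[[aa bb cc ca [abs bct]] cpc cqa _] := fsat.
set a := f i0 in aa ca abs cpc cqa; set b := f i1 in bb abs bct cpc cqa.
set c := f i2 in cc ca bct cpc cqa.
(* The presentation of the quotient by p = (ab)^4 and q = (bc)^4. *)
pose R' := (R1 s t ++ [:: E; (r0 * r1) ^+ 4; (r1 * r2) ^+ 4])%W.
have [k [l [e [j [kB lB j4 wnf]]]]] : exists k l (e : bool) j,
    [/\ k < B1, l < B2, j < 4 &
      pres_eq R' w (word_trX ^+ k * word_trY ^+ l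
                      * (r1 ^+ e * (r1 * r2) ^+ j))%W].
  have /satisfies_R1[[Kaa Kbb Kcc Kca _] _ _] := @pres_satisfies _ R'.
  rewrite !satisfies_cons !word_evalE => -[KE [Kab4 [Kbc4 _]]].
  have := torE _ _ Kaa Kbb Kcc Kca Kab4 Kbc4 KE.
  rewrite !word_evalE => -[XYB YB].
  have [k [l [e [j [kB lB j4 wE]]]]] :=
    torus_normal_form Kaa Kbb Kcc Kca Kab4 Kbc4 B1_gt0 B2_gt0 XYB YB w.
  exists k, l, e, j; split=> //; apply/pres_evalP.
  by rewrite wE !word_evalE.
set p := (a * b) ^+ 4 in cpc; set q := (b * c) ^+ 4 in cqa.
have p4 z n : 2 <= n -> z ^+ (2 ^ n) = (z ^+ 4) ^+ (2 ^ (n - 2)) :> H.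
  by move=> n2; rewrite -expgnA -(expnD 2 2) subnKC.
have pm : p ^+ (2 ^ (s - 2)) = 1 by rewrite -p4.
have qm : q ^+ (2 ^ (t - 2)) = 1 by rewrite -p4.
have rotJ (g h : H) n : g * g = 1 -> h * h = 1 ->
    ((g * h) ^+ n) ^ g = ((g * h) ^+ n)^-1
    /\ ((g * h) ^+ n) ^ h = ((g * h) ^+ n)^-1.
  by move=> gg hh; rewrite !conjXg -!expVgn; have [-> ->] := rotation_conj gg hh.
have [pa pb] := rotJ a b 4 aa bb; have [qb qc] := rotJ b c 4 bb cc.
rewrite -/p in pa pb; rewrite -/q in qb qc.
have cpq : commute p q.
  apply: conjg_fix_commute; rewrite /q (expgnDr _ 2 2) expg2.
  by rewrite !conjgM !(pb, conjVg, invgK, commute_conjg cpc).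
have m0 n : 0 < 2 ^ n by rewrite expn_gt0.
have pq0 : p ^+ (2 ^ (s - 2)) = q ^+ 0 by [].
have LV := rank2V cpq (m0 _) (m0 _) pq0 qm.
have Lp := rank2_l p q; have Lq := rank2_r p q.
have PJ x v : rank2_span p q x -> rank2_span p q (x ^ word_eval f v).
  move: x; apply: (eval_invol_ind (S := fun g => forall x, rank2_span p q x ->
                                                   rank2_span p q (x ^ g))).
  - exact: ord3_ind.
  - by move=> x; rewrite conjg1.
  - apply: ord3_ind => g Jg x Lx; rewrite conjgM; apply: Jg; apply: rank2J => //.
    + by rewrite pa; apply: LV.
    + by rewrite (commute_conjg cqa).
    + by rewrite pb; apply: LV.
    + by rewrite qb; apply: LV.
    + by rewrite (commute_conjg cpc).
    + by rewrite qc; apply: LV.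
have PR r : r \in R' -> rank2_span p q (word_eval f r).
  rewrite /R' -cat1s catA mem_cat => /orP[rR|].
    by rewrite (fsat r rR); apply: rank2_1.
  by rewrite !inE => /orP[] /eqP ->; rewrite !word_evalE.
have [i [j' /(canRL (mulKVg _)) ->]] :=
  eval_mod_normal (rank2M cpq) LV PJ (rank2_1 p q) PR wnf.
exists k, l, e, ((j + 4 * j') %% 2 ^ t), (i %% 2 ^ (s - 2)); rewrite !ltn_mod.
split=> //; rewrite /word_lt !word_evalE -(expg_modn _ bct) expgnA.
rewrite -(expg_modn _ pm) (commuteX2 _ _ cpq) (expgnDr _ j) (expgnA _ 4 j').
by rewrite !mulgA.
Qed.

(** Here the relator is Y^(2N), and conjugation by [b] gives X^(2N). *)
Lemma torus_relator_odd N :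
  torus_relator ([~ (r0 * r1) ^+ 2, r2] ^+ N)%W (2 * N) (2 * N).
Proof.
move=> K f aa bb cc ca ab4 bc4; rewrite !word_evalE.
rewrite (commg_sqr_ab_c aa bb cc ca) -expgnA => YN; rewrite YN; split=> //.
have := congr1 (fun z => z ^ f i1) YN; rewrite conj1g conjXg.
by rewrite -(trX_conj_b (f i0) (f i2) bb) -conjgM bb conjg1 mulg1.
Qed.

(** Here the relator is (XY)^(2N), and conjugation by [a], which inverts [X] and
    fixes [Y], turns it into a relation that yields Y^(4N). *)
Lemma torus_relator_even N :
  torus_relator ([~ (r0 * r1) ^+ 2, (r1 * r2) ^+ 2] ^+ N)%W (2 * N) (4 * N).
Proof.
move=> K f aa bb cc ca ab4 bc4; rewrite !word_evalE.
rewrite (commg_sqr_ab_sqr_bc aa bb cc ca).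
set X := (f i0 * _); set Y := (f i1 * _ * _ * _).
have abab := rotation4_swap aa bb ab4.
have cbcb : f i2 * (f i1 * (f i2 * f i1)) = f i1 * (f i2 * (f i1 * f i2)).
  by rewrite -(rotation4_swap bb cc bc4).
have cXY : commute X Y by exact: trX_trY_commute.
rewrite -cXY -expg2 -expgnA expgMn // => XYN; split=> //.
have Xa : X ^ f i0 = X^-1 by apply: trX_conj_a.
have Ya : Y ^ f i0 = Y by apply: trY_conj_a.
have := congr1 (fun z => z ^ f i0) XYN; rewrite conj1g conjMg !conjXg Xa Ya.
rewrite expVgn => /mulg1_eq; rewrite invgK => XeqY.
by rewrite -XYN XeqY -expgnDr addnn -mul2n mulnA.
Qed.

(** * Affine permutations over Z / 2^n *)

Import GRing.Theory GroupScope.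

Lemma expn2_pred i : 0 < i -> (2 ^ i = 2 * 2 ^ (i - 1))%N.
Proof. by move=> i0; rewrite -expnS; congr (2 ^ _)%N; lia. Qed.

Lemma expn2_pred2 i : 1 < i -> (2 ^ (i - 1) = 2 * 2 ^ (i - 2))%N.
Proof. by move=> i1; rewrite -expnS; congr (2 ^ _)%N; lia. Qed.

Lemma expn2_4 i : 1 < i -> (2 ^ i = 4 * 2 ^ (i - 2))%N.
Proof. by move=> i1; rewrite -(expnD 2 2); congr (2 ^ _)%N; lia. Qed.

Section Step.
Variable n : nat.
Hypothesis n0 : 0 < n.
Local Open Scope ring_scope.

(** The generator of the subgroup of order [2 ^ b] of Z / 2^n: with it, cyclic
    coordinates of various orders live in one ring. *)
Definition step b : 'Z_(2 ^ n) := (2 ^ (n - b))%:R.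

Lemma step_mulrn_eq0 b k : (b <= n)%N -> (step b *+ k == 0) = (2 ^ b %| k)%N.
Proof.
move=> bn; have n1 : (1 < 2 ^ n)%N by rewrite -{1}(expn0 2) ltn_exp2l.
rewrite /step -mulrnA -val_eqE /= val_Zp_nat // -/(_ %| _)%N.
by rewrite -{1}(subnK bn) expnD dvdn_pmul2l // expn_gt0.
Qed.

Lemma step_mulrn_inj b i j :
    (b <= n)%N -> (i < 2 ^ b)%N -> (j < 2 ^ b)%N ->
  step b *+ i = step b *+ j -> i = j.
Proof.
move=> bn; wlog ij : i j / (i <= j)%N => [hw ib jb e|].
  by case/orP: (leq_total i j) => le; [apply: hw | apply/esym/hw].
move=> ib jb e; have : step b *+ (j - i) == 0 by rewrite mulrnBr // e subrr.
rewrite step_mulrn_eq0 // => /dvdn_leq; lia.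
Qed.

Lemma step_mul2X b j : (j <= b <= n)%N -> step b *+ 2 ^ j = step (b - j).
Proof.
move=> jb; rewrite /step -mulrnA -expnD; congr (2 ^ _)%:R; lia.
Qed.

Lemma step0 : step 0 = 0.
Proof. by apply/eqP; rewrite -[step 0]mulr1n step_mulrn_eq0. Qed.

Lemma step_neq0 b : (0 < b <= n)%N -> step b != 0.
Proof.
move=> /andP[b0 bn]; rewrite -[step b]mulr1n step_mulrn_eq0 // dvdn1.
by rewrite -(expn0 2) eqn_exp2l // -lt0n.
Qed.

Lemma Z2n_one_neqN1 : (1 < n)%N -> 1 <> -1 :> 'Z_(2 ^ n).
Proof.
move=> n1 /eqP; rewrite -subr_eq0 opprK.
have := @step_mulrn_eq0 n 2 (leqnn n); rewrite /step subnn => ->.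
by rewrite (dvdn_Pexp2l _ 1) // leqNgt n1.
Qed.

End Step.

Section Perms.

Lemma order_pow2 (gT : finGroupType) (g : gT) s :
  0 < s -> g ^+ (2 ^ s) = 1 -> g ^+ (2 ^ (s - 1)) != 1 -> #[g] = (2 ^ s)%N.
Proof.
move=> s0 gs; rewrite -order_dvdn => ndiv.
have /(dvdn_pfactor _ _ (isT : prime 2))[m ms om] : #[g] %| 2 ^ s.
  by rewrite order_dvdn gs.
rewrite om; congr (2 ^ _)%N; apply/eqP; rewrite eqn_leq ms leqNgt.
by apply: contra ndiv => lt; rewrite om dvdn_exp2l //; lia.
Qed.

Lemma order_invol (gT : finGroupType) (g : gT) : g * g = 1 -> g != 1 -> #[g] = 2.
Proof. by move=> gg g1; apply: (@order_pow2 _ _ 1). Qed.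

(** [pi] is a coordinate, or the identity, along which [g] translates. *)
Lemma perm_shiftX (V : finType) (A : zmodType) (pi : V -> A) (g : {perm V}) t :
  (forall v, pi (g v) = pi v + t)%R ->
  forall k v, pi ((g ^+ k) v) = (pi v + t *+ k)%R.
Proof.
move=> gt; elim=> [|k IHk] v; first by rewrite expg0 perm1 mulr0n addr0.
by rewrite expgSr permM gt IHk mulrSr addrA.
Qed.

Lemma perm_fixX (V : finType) (A : Type) (pi : V -> A) (g : {perm V}) :
  (forall v, pi (g v) = pi v) -> forall k v, pi ((g ^+ k) v) = pi v.
Proof.
move=> gt; elim=> [|k IHk] v; first by rewrite expg0 perm1.
by rewrite expgSr permM gt IHk.
Qed.

Lemma perm_invol (V : finType) (h : V -> V) (hK : involutive h) :
  perm (inv_inj hK) * perm (inv_inj hK) = 1.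
Proof. by apply/permP=> v; rewrite permM !permE hK. Qed.

Lemma permX_bool (V : finType) (g : {perm V}) (e : bool) v :
  (g ^+ e)%g v = if e then g v else v.
Proof. by case: e; rewrite ?expg1 // expg0 perm1. Qed.

Lemma pairD (U W : zmodType) (x x' : U) (y y' : W) :
  ((x, y) + (x', y') = (x + x', y + y'))%R.
Proof. by []. Qed.

Lemma pairMn (U W : zmodType) (x : U) (y : W) m :
  ((x, y) *+ m = (x *+ m, y *+ m))%R.
Proof. by elim: m => [|m IHm] //; rewrite !mulrS IHm. Qed.

Lemma affine_eq_linear (V : zmodType) (L L' : V -> V) (d d' : V) :
  {morph L : x y / (x + y)%R} -> {morph L' : x y / (x + y)%R} ->
  (forall v, L (v + d)%R = L' (v + d')%R) -> forall v, L v = L' v.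
Proof.
move=> LD L'D E v; apply: (addIr (L d)).
by rewrite -LD E L'D; congr (_ + _)%R; rewrite -[d']add0r -E add0r.
Qed.

End Perms.

Definition gens (gT : Type) (a b c : gT) (i : 'I_3) : gT :=
  match val i with 0 => a | 1 => b | _ => c end.

(** ** The case s = t, s + t > n *)

(** The lattice is Z x + Z w modulo 2^t x and 2^k w, for x = ab and
    w = (ab)^2 (bc)^2.  The generator [a] acts on it by -1 and [c] by x |-> w - x,
    w |-> w; since b = a x, [b] acts by -1 followed by a translation.  When k = 0
    the product ac acts trivially on the lattice, hence the third coordinate, on
    which [a] and [b] change the sign. *)
Section ModelGt.
Variables (n t : nat).
Hypotheses (t2 : 2 <= t) (tn : t <= n - 2) (nt : n < t + t).

Local Notation R := 'Z_(2 ^ n).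
Local Notation k := (n - t - 2)%N.
Local Notation V := (R * R * R)%type.
Local Open Scope ring_scope.
Let g : R := step n t.
Let eta : R := (2 ^ (t - k))%:R.

Let n0 : (0 < n)%N. Proof. lia. Qed.
Let n1 : (1 < n)%N. Proof. lia. Qed.
Let neg1 : (1 : R) <> -1. Proof. exact: Z2n_one_neqN1. Qed.

(* The translation by w is the one by [(0, eta * g)]. *)
Let etag : eta * g = step n k.
Proof. by rewrite mulr_natl step_mul2X; first (congr (step n _); lia); lia. Qed.

Let fa (v : V) : V := (- v.1.1, - v.1.2, - v.2).
Let fb (v : V) : V := (g - v.1.1, - v.1.2, - v.2).
Let fc (v : V) : V := (- v.1.1, v.1.2 + eta * v.1.1, v.2).
Let faK : involutive fa.
Proof. by move=> [[x y] z]; rewrite /fa /= !opprK. Qed.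
Let fbK : involutive fb.
Proof. by move=> [[x y] z]; rewrite /fb /=; congr (_, _, _); ring. Qed.
Let fcK : involutive fc.
Proof. by move=> [[x y] z]; rewrite /fc /=; congr (_, _, _); ring. Qed.
Let a := perm (inv_inj faK).
Let b := perm (inv_inj fbK).
Let c := perm (inv_inj fcK).
Let f := gens a b c.

Let fE : (f i0 = a) * (f i1 = b) * (f i2 = c). Proof. by []. Qed.
Let aE x y z : a (x, y, z) = (- x, - y, - z). Proof. exact: permE. Qed.
Let bE x y z : b (x, y, z) = (g - x, - y, - z). Proof. exact: permE. Qed.
Let cE x y z : c (x, y, z) = (- x, y + eta * x, z). Proof. exact: permE. Qed.
Let pE := (aE, bE, cE, @permM).

Let aa : (a * a = 1)%g. Proof. exact: perm_invol. Qed.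
Let bb : (b * b = 1)%g. Proof. exact: perm_invol. Qed.
Let cc : (c * c = 1)%g. Proof. exact: perm_invol. Qed.
Let ca : (c * a = a * c)%g.
Proof. by apply/permP=> [[[x y] z]]; rewrite !pE; congr (_, _, _); ring. Qed.

Let shiftX (h : {perm V}) d : (forall v, h v = v + d) ->
  forall m v, (h ^+ m)%g v = v + d *+ m.
Proof. exact: (perm_shiftX (A := V) (pi := id)). Qed.

Let shift_eq1 (h : {perm V}) d m :
  (forall v, h v = v + d) -> d *+ m = 0 -> (h ^+ m = 1)%g.
Proof. by move=> hd dm; apply/permP=> v; rewrite (shiftX hd) dm addr0 perm1. Qed.

Let abE v : (a * b)%g v = v + (g, 0, 0).
Proof. by case: v => [[x y] z]; rewrite !pE !pairD; congr (_, _, _); ring. Qed.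

Let bc2E v : ((b * c) ^+ 2)%g v = v + (- (g *+ 2), eta * g, 0).
Proof.
by case: v => [[x y] z]; rewrite expg2 !pE !pairD; congr (_, _, _); ring.
Qed.

Let wE v : ((a * b) ^+ 2 * (b * c) ^+ 2)%g v = v + (0, eta * g, 0).
Proof.
case: v => [[x y] z]; rewrite permM bc2E (shiftX abE) !pairMn !pairD /=.
by congr (_, _, _); ring.
Qed.

Let sat : satisfies (relators_gt n t t) f.
Proof.
have t0 : (0 < t)%N by lia.
apply/satisfies_R2; rewrite !fE; split; first split=> //.
  split.
    apply: (shift_eq1 abE).
    by rewrite !pairMn step_mul2X ?subnn ?step0 ?mul0rn //; lia.
  rewrite (expn2_pred t0) expgnA; apply: (shift_eq1 bc2E).
  rewrite !pairMn etag mul0rn mulNrn -(mulrnA g) -expnS; congr (_, _, _);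
  by apply/eqP; rewrite ?oppr_eq0 step_mulrn_eq0 ?dvdn_exp2l //; lia.
rewrite !satisfies_cons !word_evalE !fE; split; last split=> //.
  have -> : (n - t - 1)%N = k.+1 by lia.
  apply/permP=> v; rewrite permM perm1 (shiftX abE) expnS expgnA (shiftX bc2E).
  rewrite -addrA !pairMn !mul0rn etag mulNrn -(mulrnA g) !pairD subrr add0r addr0.
  have /eqP -> : step n k *+ 2 ^ k == 0 by rewrite step_mulrn_eq0 //; lia.
  exact: addr0.
rewrite commgEl (invol_conjE _ cc) -mulgA.
suff -> : (c * ((a * b) ^+ 2) * c * (c * b) ^+ 4 = (a * b) ^+ 2)%g.
  by rewrite mulVg.
apply/permP=> [[[x y] z]]; rewrite (expgnDr _ 2 2) !expg2 !pE.
by congr (_, _, _); ring.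
Qed.

Let nf (i : 'I_(2 ^ t) * 'I_(2 ^ k) * bool * bool) : word 'I_3 :=
  ((r0 * r1) ^+ i.1.1.1 * ((r0 * r1) ^+ 2 * (r1 * r2) ^+ 2) ^+ i.1.1.2
     * r0 ^+ i.1.2 * r2 ^+ i.2)%W.

Let lin (e h : bool) : V -> V :=
  (if h then fc else id) \o (if e then fa else id).

Let nfE i j e h v :
  word_eval f (nf (i, j, e, h)) v = lin e h (v + (g *+ i, eta * g *+ j, 0)).
Proof.
rewrite /nf !word_evalE !fE /= 3!permM !permX_bool (shiftX abE) (shiftX wE).
rewrite -addrA !pairMn !mul0rn !pairD !addr0 !add0r.
by case: h; case: e; rewrite ?permE.
Qed.

Let linD e h : {morph lin e h : v w / v + w}.
Proof.
case: h; case: e; move=> [[x y] z] [[x' y'] z'] //=;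
by rewrite /fa /fc !pairD /=; congr (_, _, _); ring.
Qed.

Let lin_inj e h : injective (lin e h).
Proof.
apply: inj_comp; [case: h | case: e] => //; apply: can_inj;
  [exact: fcK | exact: faK].
Qed.

Let nf_inj : injective (fun i => word_eval f (nf i)).
Proof.
move=> [[[i j] e] h] [[[i' j'] e'] h'] /permP E.
have {}E v := etrans (esym (nfE i j e h v)) (etrans (E v) (nfE i' j' e' h' v)).
have [ee hh] : e = e' /\ h = h'.
  have /(_ (1, 0, 1)) l := affine_eq_linear (linD e h) (linD e' h') E.
  (* The third coordinate tells e, then the first one tells h. *)
  have l1 := congr1 (fun v : V => v.1.1) l; have l3 := congr1 snd l.
  by clear E l; case: h h' e e' l1 l3 => [] [] [] [] //=;
     rewrite ?opprK => l1 l3; case: neg1.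
move: E; rewrite -{}ee -{}hh => /(_ 0) /lin_inj; rewrite !add0r etag => T.
have kn : (k <= n)%N by lia.
have ii : i = i'.
  apply/val_inj/(step_mulrn_inj n0 _ (ltn_ord i) (ltn_ord i')); first by lia.
  exact: (congr1 (fun v : V => v.1.1) T).
have jj : j = j'.
  apply/val_inj/(step_mulrn_inj n0 kn (ltn_ord j) (ltn_ord j')).
  exact: (congr1 (fun v : V => v.1.2) T).
by rewrite ii jj.
Qed.

Lemma regular_map_gt : exists M : regular_map,
  [/\ map_order M = (2 ^ n)%N, map_type M (2 ^ t) (2 ^ t)
    & Aut_presented_by M (relators_gt n t t)].
Proof.
have ord2 : forall i, #[f i]%g = 2.
  apply: ord3_ind; rewrite fE; apply: order_invol => //; apply/eqP => /permP E.
  - by have := congr1 snd (E (0, 0, 1)); rewrite aE perm1 => /esym.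
  - by have := congr1 snd (E (0, 0, 1)); rewrite bE perm1 => /esym.
  - have := congr1 (fun v : V => v.1.1) (E (1, 0, 0)).
    by rewrite cE perm1 => /esym.
have ac2 : #[f i0 * f i2]%g = 2.
  rewrite !fE; apply: order_invol; first exact: invol_mul_invol.
  apply/eqP=> /permP E; have := congr1 snd (E (0, 0, 1)).
  by rewrite !pE perm1 => /esym.
have t0 : (0 < t)%N by lia.
have [[_ _ _ _ [abt bct]] _] := (satisfies_R2 _ _ _ _).1 sat.
rewrite !fE in abt bct.
have gt : g *+ 2 ^ (t - 1) = step n 1.
  by rewrite step_mul2X; first (congr (step n _); lia); lia.
have s1 : step n 1 != 0 by apply: step_neq0; lia.
have oab : #[f i0 * f i1]%g = (2 ^ t)%N.
  rewrite !fE; apply: (order_pow2 t0 abt); apply/eqP => /permP /(_ 0).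
  rewrite (shiftX abE) perm1 add0r !pairMn gt.
  by move/(congr1 (fun v : V => v.1.1))/eqP; rewrite (negPf s1).
have obc : #[f i1 * f i2]%g = (2 ^ t)%N.
  rewrite !fE; apply: (order_pow2 t0 bct); apply/eqP => /permP /(_ 0).
  rewrite (expn2_pred2 t2) expgnA (shiftX bc2E) perm1 add0r !pairMn.
  move/(congr1 (fun v : V => v.1.1))/eqP => /=.
  by rewrite mulNrn -(mulrnA g) -expn2_pred2 // gt oppr_eq0 (negPf s1).
have cover (H : groupType) (h : 'I_3 -> H) : satisfies (relators_gt n t t) h ->
    forall w, exists i, word_eval h w = word_eval h (nf i).
  move=> hR w; have tt : (2 <= t <= n - 2)%N by lia.
  have [i [j [e [l [it jt ->]]]]] := normal_form_gt tt hR w.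
  by exists (Ordinal it, Ordinal jt, e, l); rewrite /nf !word_evalE.
have [M [oM tM pM]] := map_of_normal_forms sat ord2 ac2 nf_inj cover.
rewrite oab obc in tM; exists M; split=> //.
rewrite oM !card_prod !card_ord card_bool -expnD -!expnSr; congr (2 ^ _)%N; lia.
Qed.

End ModelGt.

(** ** The case s + t = n *)

(** The product of two dihedral groups acts on pairs (x, y) modulo (2^s, 2^t) by
    a : x |-> - x, c : y |-> - y and b : (x, y) |-> (1 - x, 1 - y).  The relation
    (ab)^(2^(s-1)) (bc)^(2^(t-1)) = 1 identifies (2^(s-1), 2^(t-1)) with 0, and
    (x, y) |-> (g1 x + g2 y, g1 x - g2 y) embeds this quotient into (Z / 2^n)^2;
    in these coordinates [a] and [c] exchange the components, up to sign. *)
Section ModelEq.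
Variables (n s t : nat).
Hypotheses (s2 : 2 <= s) (t2 : 2 <= t) (stn : s + t = n).

Local Notation R := 'Z_(2 ^ n).
Local Notation V := (R * R)%type.
Local Open Scope ring_scope.
Let g1 : R := step n s.
Let g2 : R := step n t.

Let n0 : (0 < n)%N. Proof. lia. Qed.
Let n1 : (1 < n)%N. Proof. lia. Qed.
Let neg1 : (1 : R) <> -1. Proof. exact: Z2n_one_neqN1. Qed.
Let one0 : (0 : R) <> 1. Proof. by apply/eqP; rewrite eq_sym oner_neq0. Qed.

Let fa (v : V) : V := (- v.2, - v.1).
Let fb (v : V) : V := (g1 + g2 - v.1, g1 - g2 - v.2).
Let fc (v : V) : V := (v.2, v.1).
Let faK : involutive fa.
Proof. by move=> [x y]; rewrite /fa /= !opprK. Qed.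
Let fbK : involutive fb.
Proof. by move=> [x y]; rewrite /fb /=; congr (_, _); ring. Qed.
Let fcK : involutive fc. Proof. by move=> [x y]. Qed.
Let a := perm (inv_inj faK).
Let b := perm (inv_inj fbK).
Let c := perm (inv_inj fcK).
Let f := gens a b c.

Let fE : (f i0 = a) * (f i1 = b) * (f i2 = c). Proof. by []. Qed.
Let aE x y : a (x, y) = (- y, - x). Proof. exact: permE. Qed.
Let bE x y : b (x, y) = (g1 + g2 - x, g1 - g2 - y). Proof. exact: permE. Qed.
Let cE x y : c (x, y) = (y, x). Proof. exact: permE. Qed.
Let pE := (aE, bE, cE, @permM).

Let aa : (a * a = 1)%g. Proof. exact: perm_invol. Qed.
Let bb : (b * b = 1)%g. Proof. exact: perm_invol. Qed.
Let cc : (c * c = 1)%g. Proof. exact: perm_invol. Qed.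
Let ca : (c * a = a * c)%g.
Proof. by apply/permP=> [[x y]]; rewrite !pE. Qed.

Let shiftX (h : {perm V}) d : (forall v, h v = v + d) ->
  forall m v, (h ^+ m)%g v = v + d *+ m.
Proof. exact: (perm_shiftX (A := V) (pi := id)). Qed.

Let shift_eq1 (h : {perm V}) d m :
  (forall v, h v = v + d) -> d *+ m = 0 -> (h ^+ m = 1)%g.
Proof. by move=> hd dm; apply/permP=> v; rewrite (shiftX hd) dm addr0 perm1. Qed.

Let ab2E v : ((a * b) ^+ 2)%g v = v + (g1 *+ 2, g1 *+ 2).
Proof. by case: v => [x y]; rewrite expg2 !pE pairD; congr (_, _); ring. Qed.

Let bc2E v : ((b * c) ^+ 2)%g v = v + (- (g2 *+ 2), g2 *+ 2).
Proof. by case: v => [x y]; rewrite expg2 !pE pairD; congr (_, _); ring. Qed.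

Let abcE v : (a * b * c)%g v = v + (g1 - g2, g1 + g2).
Proof. by case: v => [x y]; rewrite !pE pairD; congr (_, _); ring. Qed.

Let step_half i : (0 < i <= n)%N -> step n i *+ 2 = step n (i - 1).
Proof. by move=> iP; have := @step_mul2X n n0 i 1 iP; rewrite expn1. Qed.

Let step2X i : (0 < i <= n)%N -> step n i *+ 2 *+ 2 ^ (i - 1) = 0.
Proof.
move=> iP; rewrite -mulrnA -expn2_pred; last by lia.
by rewrite step_mul2X ?subnn ?step0 //; lia.
Qed.

Let step2X1 i : (1 < i <= n)%N -> step n i *+ 2 *+ 2 ^ (i - 2) = step n 1.
Proof.
move=> iP; rewrite -mulrnA -expn2_pred2; last by lia.
by rewrite step_mul2X; first (congr (step n _); lia); lia.
Qed.

Let sat : satisfies (relators_eq s t) f.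
Proof.
apply/satisfies_R2; rewrite !fE; split; first split=> //.
  split; [rewrite (expn2_pred (ltnW s2)) | rewrite (expn2_pred (ltnW t2))];
    rewrite expgnA.
    by apply: (shift_eq1 ab2E); rewrite !pairMn step2X //; lia.
  by apply: (shift_eq1 bc2E); rewrite !pairMn mulNrn step2X ?oppr0 //; lia.
rewrite !satisfies_cons !word_evalE !fE; split; last split=> //.
  apply/eqP/commgP/permP=> [[x y]].
  by rewrite expg2 !pE; congr (_, _); ring.
apply/permP=> v; rewrite permM perm1 (expn2_pred2 s2) (expn2_pred2 t2).
rewrite !expgnA (shiftX ab2E) (shiftX bc2E) -addrA !pairMn mulNrn.
rewrite !step2X1 ?pairD; try lia.
have -> : step n 1 + step n 1 = 0.
  by rewrite -mulr2n step_half // subnn; apply: step0.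
by rewrite subrr addr0.
Qed.

Let nf (i : 'I_(2 ^ (t - 1)) * 'I_(2 ^ (s - 1)) * bool * bool) : word 'I_3 :=
  ((r0 * r1 * r2) ^+ i.1.1.1 * ((r0 * r1) ^+ 2) ^+ i.1.1.2
     * r0 ^+ i.1.2 * r2 ^+ i.2)%W.

Let lin (e h : bool) : V -> V :=
  (if h then fc else id) \o (if e then fa else id).

Let nfE i j e h v : word_eval f (nf (i, j, e, h)) v =
  lin e h (v + ((g1 - g2) *+ i + g1 *+ 2 *+ j, (g1 + g2) *+ i + g1 *+ 2 *+ j)).
Proof.
rewrite /nf !word_evalE !fE /= 3!permM !permX_bool (shiftX abcE) (shiftX ab2E).
rewrite -addrA !pairMn !pairD.
by case: h; case: e; rewrite ?permE.
Qed.

Let linD e h : {morph lin e h : v w / v + w}.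
Proof.
by case: h; case: e; move=> [x y] [z w] //=; rewrite /fa /fc /= ?opprD.
Qed.

Let lin_inj e h : injective (lin e h).
Proof.
apply: inj_comp; [case: h | case: e] => //; apply: can_inj;
  [exact: fcK | exact: faK].
Qed.

Let nf_inj : injective (fun i => word_eval f (nf i)).
Proof.
move=> [[[i j] e] h] [[[i' j'] e'] h'] /permP E.
have {}E v := etrans (esym (nfE i j e h v)) (etrans (E v) (nfE i' j' e' h' v)).
have [ee hh] : e = e' /\ h = h'.
  (* The four linear parts send (1, 0) to distinct vectors. *)
  have /(_ (1, 0)) l := affine_eq_linear (linD e h) (linD e' h') E.
  have oneN0 : (0 : R) <> -1 by move/eqP; rewrite eq_sym oppr_eq0 oner_eq0.
  have l1 := congr1 fst l; have l2 := congr1 snd l; clear E l.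
  case: h h' e e' l1 l2 => [] [] [] [] //=; rewrite ?oppr0 => l1 l2;
  by [case: neg1 | case: one0 | case: oneN0].
move: E; rewrite -{}ee -{}hh => /(_ 0) /lin_inj; rewrite !add0r => T.
have T1 := congr1 fst T; have {T}T2 := congr1 snd T; rewrite /= in T1 T2.
have ii : i = i'.
  apply/val_inj/(step_mulrn_inj n0 _ (ltn_ord i) (ltn_ord i')); first by lia.
  have diff m : g2 *+ 2 *+ m = ((g1 + g2) *+ m + g1 *+ 2 *+ j)
                                 - ((g1 - g2) *+ m + g1 *+ 2 *+ j) by ring.
  by rewrite -step_half; [rewrite diff T1 T2; ring | lia].
rewrite -{}ii in T1 *; have jj : j = j'.
  apply/val_inj/(step_mulrn_inj n0 _ (ltn_ord j) (ltn_ord j')); first by lia.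
  by rewrite -step_half; [exact: (addrI _ T1) | lia].
by rewrite jj.
Qed.

Lemma regular_map_eq : exists M : regular_map,
  [/\ map_order M = (2 ^ n)%N, map_type M (2 ^ s) (2 ^ t)
    & Aut_presented_by M (relators_eq s t)].
Proof.
have ord2 : forall i, #[f i]%g = 2.
  apply: ord3_ind; rewrite fE; apply: order_invol => //; apply/eqP => /permP E.
  - by have := congr1 fst (E (1, 0)); rewrite perm1 aE /= oppr0.
  - have := congr1 fst (E (1, 0)); have := congr1 fst (E (0, 0)).
    by rewrite !perm1 !bE /= subr0 => ->; rewrite sub0r => /esym.
  - by have := congr1 fst (E (1, 0)); rewrite perm1 cE.
have ac2 : #[f i0 * f i2]%g = 2.
  rewrite !fE; apply: order_invol; first exact: invol_mul_invol.
  apply/eqP=> /permP E; have := congr1 fst (E (1, 0)).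
  by rewrite !pE perm1 => /esym.
have [[_ _ _ _ [abs bct]] _] := (satisfies_R2 _ _ _ _).1 sat.
rewrite !fE in abs bct.
have s1 : step n 1 != 0 by apply: step_neq0; lia.
have oab : #[f i0 * f i1]%g = (2 ^ s)%N.
  rewrite !fE; apply: (order_pow2 (ltnW s2) abs); apply/eqP => /permP /(_ 0).
  rewrite (expn2_pred2 s2) expgnA (shiftX ab2E) perm1 add0r !pairMn.
  by move/(congr1 fst) => /=; rewrite step2X1; [apply/eqP | lia].
have obc : #[f i1 * f i2]%g = (2 ^ t)%N.
  rewrite !fE; apply: (order_pow2 (ltnW t2) bct); apply/eqP => /permP /(_ 0).
  rewrite (expn2_pred2 t2) expgnA (shiftX bc2E) perm1 add0r !pairMn.
  by move/(congr1 snd) => /=; rewrite step2X1; [apply/eqP | lia].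
have cover (H : groupType) (h : 'I_3 -> H) : satisfies (relators_eq s t) h ->
    forall w, exists i, word_eval h w = word_eval h (nf i).
  move=> hR w.
  have [i [j [e [l [it jt ->]]]]] := normal_form_eq s2 t2 hR w.
  by exists (Ordinal it, Ordinal jt, e, l); rewrite /nf !word_evalE.
have [M [oM tM pM]] := map_of_normal_forms sat ord2 ac2 nf_inj cover.
rewrite oab obc in tM; exists M; split=> //.
rewrite oM !card_prod !card_ord card_bool -expnD -!expnSr; congr (2 ^ _)%N; lia.
Qed.

End ModelEq.

(** ** The case s + t < n *)

(** The first pair of coordinates is the torus: the point (k, l) of the square
    lattice is recorded as k modulo 2^b1 and l - k modulo 2^b2, which is well
    defined modulo both (2^b1, 2^b1) and (0, 2^b2).  Scaled to Z / 2^n,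
    passing from one modulus to the other costs the factors [lam] and [kap], of
    product 2.  On the second pair act the dihedral quotients of orders
    2^(s+1), where [c] is trivial, and 2^(t+1), where [a] is trivial. *)
Section ModelLt.
Variables (n s t b1 b2 : nat).
Hypotheses (s2 : 2 <= s) (t2 : 2 <= t).
Hypotheses (b1_gt0 : 0 < b1) (b12 : b1 <= b2 <= b1 + 1).
Hypothesis sumn : s + t + b1 + b2 = n + 1.

Local Notation R := 'Z_(2 ^ n).
Local Notation V := ((R * R) * (R * R))%type.
Local Open Scope ring_scope.
Let gs : R := step n s.
Let gt : R := step n t.
Let e2 : R := step n b2.
Let lam : R := (2 ^ (b2 - b1))%:R.
Let kap : R := (2 ^ (b1 + 1 - b2))%:R.

Let n0 : (0 < n)%N. Proof. lia. Qed.
Let n1 : (1 < n)%N. Proof. lia. Qed.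
Let neg1 : (1 : R) <> -1. Proof. exact: Z2n_one_neqN1. Qed.

Let lkP : (lam = 1 /\ kap = 1 + 1) \/ (lam = 1 + 1 /\ kap = 1).
Proof.
have [b2E|b2E] : b2 = b1 \/ b2 = (b1 + 1)%N by lia.
  by left; rewrite /lam /kap b2E subnn addnC addnK.
by right; rewrite /lam /kap b2E subnn addnC addnK.
Qed.

Let lam_e2 : lam * e2 = step n b1.
Proof. by rewrite mulr_natl step_mul2X; first (congr (step n _); lia); lia. Qed.

Let fa (v : V) : V :=
  ((lam * e2 - v.1.1, v.1.2 + kap * v.1.1 - e2), (- v.2.1, v.2.2)).
Let fb (v : V) : V :=
  ((v.1.1 + lam * v.1.2, - v.1.2), (gs - v.2.1, gt - v.2.2)).
Let fc (v : V) : V :=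
  ((v.1.1, - v.1.2 - kap * v.1.1), (v.2.1, - v.2.2)).
Let faK : involutive fa.
Proof.
move=> [[x y] [z w]]; rewrite /fa /=; congr ((_, _), (_, _)); try ring.
by case: lkP => -[-> ->]; ring.
Qed.
Let fbK : involutive fb.
Proof. by move=> [[x y] [z w]]; rewrite /fb /=; congr ((_, _), (_, _)); ring. Qed.
Let fcK : involutive fc.
Proof. by move=> [[x y] [z w]]; rewrite /fc /=; congr ((_, _), (_, _)); ring. Qed.
Let a := perm (inv_inj faK).
Let b := perm (inv_inj fbK).
Let c := perm (inv_inj fcK).
Let f := gens a b c.

Let fE : (f i0 = a) * (f i1 = b) * (f i2 = c). Proof. by []. Qed.
Let aE x y z w :
  a ((x, y), (z, w)) = ((lam * e2 - x, y + kap * x - e2), (- z, w)).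
Proof. exact: permE. Qed.
Let bE x y z w :
  b ((x, y), (z, w)) = ((x + lam * y, - y), (gs - z, gt - w)).
Proof. exact: permE. Qed.
Let cE x y z w : c ((x, y), (z, w)) = ((x, - y - kap * x), (z, - w)).
Proof. exact: permE. Qed.
Let pE := (aE, bE, cE, @permM).
Let VE (v : V) : v = ((v.1.1, v.1.2), (v.2.1, v.2.2)).
Proof. by case: v => [[x y] [z w]]. Qed.

Ltac lk_ring := case: lkP => -[]; let l := fresh in let k := fresh in
  move=> l k; rewrite ?l ?k; ring.
Ltac V_ring :=
  rewrite !pE ?pairD; congr ((_, _), (_, _)) => /=; lk_ring.

Let aa : (a * a = 1)%g. Proof. exact: perm_invol. Qed.
Let bb : (b * b = 1)%g. Proof. exact: perm_invol. Qed.
Let cc : (c * c = 1)%g. Proof. exact: perm_invol. Qed.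
Let ca : (c * a = a * c)%g.
Proof. by apply/permP=> v; rewrite [v]VE; V_ring. Qed.

Let shiftX (h : {perm V}) d : (forall v, h v = v + d) ->
  forall m v, (h ^+ m)%g v = v + d *+ m.
Proof. exact: (perm_shiftX (A := V) (pi := id)). Qed.

Let shift_eq1 (h : {perm V}) d m :
  (forall v, h v = v + d) -> d *+ m = 0 -> (h ^+ m = 1)%g.
Proof. by move=> hd dm; apply/permP=> v; rewrite (shiftX hd) dm addr0 perm1. Qed.

Let ab4E v : ((a * b) ^+ 4)%g v = v + ((0, 0), (gs *+ 4, 0)).
Proof. by rewrite (expgnDr _ 2 2) !expg2 [v]VE; V_ring. Qed.

Let bc4E v : ((b * c) ^+ 4)%g v = v + ((0, 0), (0, - (gt *+ 4))).
Proof. by rewrite (expgnDr _ 2 2) !expg2 [v]VE; V_ring. Qed.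

Let abxE v : ((a * b)%g v).2.1 = v.2.1 + gs.
Proof. by rewrite [v]VE !pE /=; ring. Qed.

Let bcyE v : ((b * c)%g v).2.2 = v.2.2 - gt.
Proof. by rewrite [v]VE !pE /=; ring. Qed.

Let ab4yE v : (((a * b) ^+ 4)%g v).2.2 = v.2.2.
Proof. by rewrite ab4E [v]VE /= addr0. Qed.

Let X := (a * (b * c * b))%g.
Let Y := (b * a * b * c)%g.

Let XE x y z w :
  X ((x, y), (z, w)) = ((x - lam * e2, y + e2), (- z, gt *+ 2 - w)).
Proof. by rewrite /X; V_ring. Qed.

Let YE x y z w :
  Y ((x, y), (z, w)) = ((x, y - e2), (gs *+ 2 - z, - w)).
Proof. by rewrite /Y; V_ring. Qed.

Let XtE v : (X v).1 = v.1 + (- (lam * e2), e2).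
Proof. by rewrite [v]VE XE. Qed.

Let YtE v : (Y v).1 = v.1 + (0, - e2).
Proof. by rewrite [v]VE YE /= pairD addr0. Qed.

Let Y2E v : (Y ^+ 2)%g v = v + ((0, - (e2 *+ 2)), (0, 0)).
Proof.
by rewrite expg2 permM [v]VE !YE !pairD; congr ((_, _), (_, _)) => /=; ring.
Qed.

Let YXXYE v : (Y * X * (X * Y))%g v = v + ((- (lam * e2 *+ 2), 0), (0, 0)).
Proof.
rewrite 3!permM [v]VE !(XE, YE) !pairD.
by congr ((_, _), (_, _)) => /=; ring.
Qed.

Let step4X i : (1 < i)%N -> (i <= n)%N -> step n i *+ 4 *+ 2 ^ (i - 2) = 0.
Proof.
move=> i1 i_n; rewrite -mulrnA -expn2_4 //.
by rewrite step_mul2X ?leqnn // subnn step0.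
Qed.

Let ab_pow : ((a * b) ^+ (2 ^ s) = 1)%g.
Proof.
rewrite (expn2_4 s2) expgnA; apply: (shift_eq1 ab4E).
by rewrite !pairMn step4X ?mul0rn //; lia.
Qed.

Let bc_pow : ((b * c) ^+ (2 ^ t) = 1)%g.
Proof.
rewrite (expn2_4 t2) expgnA; apply: (shift_eq1 bc4E).
by rewrite !pairMn mulNrn step4X ?mul0rn ?oppr0 //; lia.
Qed.

Let sat E : word_eval f E = 1%g -> satisfies (R1 s t ++ [:: E]) f.
Proof.
move=> fE1; apply/satisfies_R1; rewrite !fE; split.
- by split.
- move: ((a * b) ^+ 4)%g ab4E => p pE4.
  apply/permP=> v; rewrite 2!permM !pE4 [v]VE pairD !cE pairD.
  by congr ((_, _), (_, _)) => /=; ring.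
- move: ((b * c) ^+ 4)%g bc4E => p pE4.
  apply/permP=> v; rewrite 2!permM !pE4 [v]VE pairD !aE pairD.
  by congr ((_, _), (_, _)) => /=; ring.
- by apply/satisfies_cons.
Qed.

Let fixes_origin (h : {perm V}) := forall v, (h v).1 = 0 <-> v.1 = 0.

Let fixes_originM h h' :
  fixes_origin h -> fixes_origin h' -> fixes_origin (h * h')%g.
Proof. by move=> hP h'P v; rewrite permM; split=> [/h'P/hP|/hP/h'P]. Qed.

Let fixes_originX h m : fixes_origin h -> fixes_origin (h ^+ m)%g.
Proof.
move=> hP; elim: m => [|m IHm] v; first by rewrite expg0 perm1.
by rewrite expgS; apply: fixes_originM.
Qed.

Let fixes_origin_b : fixes_origin b.
Proof.
have b0 v : v.1 = 0 -> (b v).1 = 0.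
  by rewrite [v]VE bE /= => -[-> ->]; rewrite mulr0 addr0 oppr0.
by move=> v; split=> [/b0|/b0]; rewrite // -permM bb perm1.
Qed.

Let fixes_origin_c : fixes_origin c.
Proof.
have c0 v : v.1 = 0 -> (c v).1 = 0.
  by rewrite [v]VE cE /= => -[-> ->]; rewrite mulr0 subr0 oppr0.
by move=> v; split=> [/c0|/c0]; rewrite // -permM cc perm1.
Qed.

Let fixes_origin_ab4 : fixes_origin ((a * b) ^+ 4)%g.
Proof. by move=> v; rewrite ab4E [v]VE !pairD /= !addr0. Qed.

Let nf (i : 'I_(2 ^ b1) * 'I_(2 ^ b2) * bool * 'I_(2 ^ t) * 'I_(2 ^ (s - 2))) :=
  word_lt i.1.1.1.1 i.1.1.1.2 i.1.1.2 i.1.2 i.2.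

Let nfE k l e J i : word_eval f (nf (k, l, e, J, i)) =
  (X ^+ k * Y ^+ l * (b ^+ e * ((b * c) ^+ J * (a * b) ^+ (4 * i))))%g.
Proof.
by rewrite /nf /word_lt !word_evalE !fE -[LHS]mulgA -(mulgA (b ^+ e)%g).
Qed.

Let nf_inj : injective (fun i => word_eval f (nf i)).
Proof.
move=> [[[[k l] e] J] i] [[[[k' l'] e'] J'] i']; rewrite !nfE.
set d := (b ^+ e * _)%g; set d' := (b ^+ e' * _)%g => E.
have dP (e0 : bool) J0 i0 :
    fixes_origin (b ^+ e0 * ((b * c) ^+ J0 * (a * b) ^+ (4 * i0)))%g.
  apply: fixes_originM (fixes_originX _ fixes_origin_b) _.
  apply: fixes_originM; first exact/fixes_originX/fixes_originM.
  by rewrite expgnA; apply: fixes_originX.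
have TE m r v : ((X ^+ m * Y ^+ r)%g v).1 =
    v.1 + (- (lam * e2) *+ m, e2 *+ m - e2 *+ r).
  rewrite permM (perm_shiftX (A := (R * R)%type) (pi := fst) YtE).
  rewrite (perm_shiftX (A := (R * R)%type) (pi := fst) XtE) -addrA !pairMn pairD.
  by congr (_ + (_, _)); ring.
(* The translation is determined by the point of the torus that is sent to the
   origin, since the other factors fix the origin. *)
have [kk ll] : k = k' /\ l = l'.
  pose p := (- (lam * e2) *+ k, e2 *+ k - e2 *+ l); pose v : V := (- p, (0, 0)).
  have : (((X ^+ k * Y ^+ l) * d)%g v).1 = 0.
    by rewrite permM; apply/(dP e J i); rewrite TE addNr.
  rewrite {}E permM => /(dP e' J' i'); rewrite TE addrC => /eqP.
  rewrite subr_eq0 => /eqP pp.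
  have kk : k = k'.
    apply/val_inj/(step_mulrn_inj n0 _ (ltn_ord k) (ltn_ord k')); first by lia.
    have := congr1 fst pp; rewrite /= !mulNrn => /oppr_inj.
    by rewrite lam_e2.
  split=> //.
  apply/val_inj/(step_mulrn_inj n0 _ (ltn_ord l) (ltn_ord l')); first by lia.
  by have := congr1 snd pp; rewrite /= -kk => /addrI/oppr_inj.
move: E; rewrite -{}kk -{}ll => /mulgI; rewrite {}/d {}/d' => /permP E.
(* The last coordinate sees neither [a] nor (ab)^4: it determines e and J. *)
have yE (e0 : bool) J0 i0 v :
    ((b ^+ e0 * ((b * c) ^+ J0 * (a * b) ^+ (4 * i0)))%g v).2.2 =
    (if e0 then gt - v.2.2 else v.2.2) + - gt *+ J0.
  rewrite 2!permM permX_bool expgnA (perm_fixX (pi := fun v : V => v.2.2) ab4yE).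
  rewrite (perm_shiftX (A := R) (pi := fun v : V => v.2.2) bcyE).
  by case: e0; rewrite // [v]VE bE.
have ee : e = e'.
  have yy y := congr1 (fun v : V => v.2.2) (E ((0, 0), (0, y))).
  have y0 := yy 0; have y1 := yy 1; rewrite !yE /= in y0 y1.
  case: e e' y0 y1 {E yy} => [] [] //= y0 y1; case: neg1.
    transitivity ((1 + - gt *+ J') - (0 + - gt *+ J')); first by ring.
    by rewrite -y0 -y1; ring.
  transitivity ((1 + - gt *+ J) - (0 + - gt *+ J)); first by ring.
  by rewrite y0 y1; ring.
have JJ : J = J'.
  apply/val_inj/(step_mulrn_inj n0 _ (ltn_ord J) (ltn_ord J')); first by lia.
  have := congr1 (fun v : V => v.2.2) (E 0); rewrite !yE -ee => /addrI.
  by rewrite !mulNrn => /oppr_inj.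
move/permP: E; rewrite -ee -JJ => /mulgI/mulgI/permP/(_ 0).
move/(congr1 (fun v : V => v.2.1)).
rewrite !(perm_shiftX (A := R) (pi := fun v : V => v.2.1) abxE) => /addrI.
move/(@step_mulrn_inj n n0 s); rewrite (expn2_4 s2) !ltn_mul2l !ltn_ord => ii.
have {}ii : i = i'.
  apply/val_inj/eqP; rewrite -(eqn_pmul2l (isT : 0 < 4)%N).
  by apply/eqP/ii => //; lia.
by rewrite ii.
Qed.

Lemma regular_map_lt E :
    torus_relator E (2 ^ b1) (2 ^ b2) -> word_eval f E = 1%g ->
  exists M : regular_map,
    [/\ map_order M = (2 ^ n)%N, map_type M (2 ^ s) (2 ^ t)
      & Aut_presented_by M (R1 s t ++ [:: E])].
Proof.
move=> torE /sat satE.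
have ord2 : forall i, #[f i]%g = 2.
  apply: ord3_ind; rewrite fE; apply: order_invol => //; apply/eqP => /permP E0.
  - have := congr1 (fun v : V => v.2.1) (E0 ((0, 0), (1, 0))).
    by rewrite perm1 aE /= => /esym.
  - have := congr1 (fun v : V => v.2.1) (E0 ((0, 0), (1, 0))).
    have := congr1 (fun v : V => v.2.1) (E0 ((0, 0), (0, 0))).
    by rewrite !perm1 !bE /= subr0 => ->; rewrite sub0r => /esym.
  - have := congr1 (fun v : V => v.2.2) (E0 ((0, 0), (0, 1))).
    by rewrite perm1 cE /= => /esym.
have ac2 : #[f i0 * f i2]%g = 2.
  rewrite !fE; apply: order_invol; first exact: invol_mul_invol.
  apply/eqP=> /permP E0.
  have := congr1 (fun v : V => v.2.1) (E0 ((0, 0), (1, 0))).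
  by rewrite !pE perm1 => /esym.
have s1 : step n 1 != 0 by apply: step_neq0; lia.
have half i : (0 < i <= n)%N -> step n i *+ 2 ^ (i - 1) = step n 1.
  by move=> iP; rewrite step_mul2X; first (congr (step n _); lia); lia.
have oab : #[f i0 * f i1]%g = (2 ^ s)%N.
  rewrite !fE; apply: (order_pow2 (ltnW s2) ab_pow); apply/eqP => /permP /(_ 0).
  move/(congr1 (fun v : V => v.2.1)).
  rewrite (perm_shiftX (A := R) (pi := fun v : V => v.2.1) abxE) perm1 add0r.
  by rewrite half; [apply/eqP | lia].
have obc : #[f i1 * f i2]%g = (2 ^ t)%N.
  rewrite !fE; apply: (order_pow2 (ltnW t2) bc_pow); apply/eqP => /permP /(_ 0).
  move/(congr1 (fun v : V => v.2.2)).
  rewrite (perm_shiftX (A := R) (pi := fun v : V => v.2.2) bcyE) perm1 add0r.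
  by rewrite mulNrn half; [apply/eqP; rewrite oppr_eq0 | lia].
have cover (H : groupType) (h : 'I_3 -> H) : satisfies (R1 s t ++ [:: E]) h ->
    forall w, exists i, word_eval h w = word_eval h (nf i).
  have p2 i : (0 < 2 ^ i)%N by rewrite expn_gt0.
  move=> hR w.
  have [k [l [e [J [i [kb lb Jb ib ->]]]]]] :=
    normal_form_lt s2 t2 (p2 b1) (p2 b2) torE hR w.
  by exists (Ordinal kb, Ordinal lb, e, Ordinal Jb, Ordinal ib).
have [M [oM tM pM]] := map_of_normal_forms satE ord2 ac2 nf_inj cover.
rewrite oab obc in tM; exists M; split=> //.
rewrite oM !card_prod !card_ord card_bool -expnD -expnSr -!expnD.
congr (2 ^ _)%N; lia.
Qed.

Lemma regular_map_lt_odd : b2 = b1 -> exists M : regular_map,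
  [/\ map_order M = (2 ^ n)%N, map_type M (2 ^ s) (2 ^ t)
    & Aut_presented_by M
        (R1 s t ++ [:: [~ (r0 * r1) ^+ 2, r2] ^+ (2 ^ (b1 - 1))%N])%W].
Proof.
move=> b21; apply: regular_map_lt.
  by rewrite b21 (expn2_pred b1_gt0); apply: torus_relator_odd.
rewrite !word_evalE !fE (commg_sqr_ab_c aa bb cc ca); apply: (shift_eq1 Y2E).
rewrite !pairMn mulNrn !mul0rn /e2 b21 -(mulrnA (step n b1)) -expn2_pred //.
by rewrite step_mul2X ?subnn ?step0 ?oppr0 //; lia.
Qed.

Lemma regular_map_lt_even : b2 = b1.+1 -> exists M : regular_map,
  [/\ map_order M = (2 ^ n)%N, map_type M (2 ^ s) (2 ^ t)
    & Aut_presented_by M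
        (R1 s t ++ [:: [~ (r0 * r1) ^+ 2, (r1 * r2) ^+ 2]
                         ^+ (2 ^ (b1 - 1))%N])%W].
Proof.
move=> b21; apply: regular_map_lt.
  by rewrite b21 expnS (expn2_pred b1_gt0) mulnA; apply: torus_relator_even.
rewrite !word_evalE !fE (commg_sqr_ab_sqr_bc aa bb cc ca).
apply: (shift_eq1 YXXYE).
rewrite lam_e2 !pairMn mulNrn !mul0rn -(mulrnA (step n b1)) -expn2_pred //.
by rewrite step_mul2X ?subnn ?step0 ?oppr0 //; lia.
Qed.

End ModelLt.

(** * Regular maps of order 2^n *)

Close Scope group_scope.

Theorem theorem3p2 (n s t : nat) (hn : 12 <= n)
    (hs : 2 <= s <= n - 2) (ht : 2 <= t <= n - 2)
    (hst : s + t <= n \/ (n < s + t /\ s = t)) :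
  exists M : regular_map,
    [/\ map_order M = 2 ^ n,
        map_type M (2 ^ s) (2 ^ t) &
        [/\ s + t <= n - 1 -> odd (n - s - t) ->
              Aut_presented_by M
                (R1 s t ++
                   [:: [~ (r0 * r1) ^+ 2, r2] ^+ (2 ^ ((n - s - t - 1) %/ 2))%N]%W),
            s + t <= n - 1 -> ~~ odd (n - s - t) ->
              Aut_presented_by M
                (R1 s t ++
                   [:: [~ (r0 * r1) ^+ 2, (r1 * r2) ^+ 2]
                         ^+ (2 ^ ((n - s - t - 2) %/ 2))%N]%W),
            s + t = n ->
              Aut_presented_by M
                (R2 s t ++
                   [:: [~ (r0 * r1) ^+ 2, r2];
                       (r0 * r1) ^+ (2 ^ (s - 1))%N
                         * (r1 * r2) ^+ (2 ^ (t - 1))%N]%W) &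
            n < s + t -> s = t ->
              Aut_presented_by M
                (R2 s t ++
                   [:: (r0 * r1) ^+ (2 ^ (n - t - 1))%N
                         * (r1 * r2) ^+ (2 ^ (n - t - 1))%N;
                       [~ (r0 * r1) ^+ 2, r2] * (r2 * r1) ^+ 4]%W)]].
Proof.
have [lt_st|gt_st|eq_st] := ltngtP (s + t) n.
- have [odd_m|even_m] := boolP (odd (n - s - t)).
    pose b1 := ((n - s - t - 1) %/ 2).+1.
    have [||||||M [oM tM pM]] := @regular_map_lt_odd n s t b1 b1;
      try by rewrite /b1; lia.
    exists M; split=> //; split=> //; try lia.
    by move: pM; rewrite /b1 subn1.
  pose b1 := ((n - s - t - 2) %/ 2).+1.
  have [||||||M [oM tM pM]] := @regular_map_lt_even n s t b1 b1.+1;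
    try by rewrite /b1; lia.
  exists M; split=> //; split=> //; try lia.
  by move: pM; rewrite /b1 subn1.
- have st : s = t by lia.
  rewrite {}st in hs hst gt_st *.
  have [M [oM tM pM]] := @regular_map_gt n t ltac:(lia) ltac:(lia) gt_st.
  by exists M; split=> //; split=> //; lia.
- have [M [oM tM pM]] := @regular_map_eq n s t ltac:(lia) ltac:(lia) eq_st.
  by exists M; split=> //; split=> //; lia.
Qed.
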